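(* If $X=(X_1,X_2,\ldots,X_n)$ is a discrete Gaussian free field which is a standard Gaussian vector, then $X^h$ is a color process for all sufficiently large $h$.
   Context: A $\{0,1\}$-valued process $(Y_i)_{i\in S}$ is a color process (divide and color process) if there are $p\in[0,1]$ and a random partition $\pi$ of $S$ such that $(Y_i)$ has the same law as the process obtained by sampling $\pi$ and then, independently of $\pi$ and independently for different partition elements, assigning all elements of a partition element the value $1$ with probability $p$ and the value $0$ with probability $1-p$. For a random vector $X=(X_i)$ and $h\in\mathbb{R}$, $X^h=(X^h_i)$ with $X^h_i=I(X_i>h)$. A Gaussian vector is standard if each marginal has mean zero and variance one. A Gaussian vector $X\sim N(0,A)$ (with $A$ an $n\times n$ positive definite covariance matrix) is a discrete Gaussian free field if and only if: (i) $A$ is, up to a permutation of the index set, a block diagonal matrix whose diagonal blocks have strictly positive entries; (ii) $A$ is an inverse Stieltjes matrix, i.e. all off-diagonal entries of $A^{-1}$ are nonpositive; (iii) $\mathbf{1}^TA^{-1}\ge \mathbf{0}$ entrywise, where $\mathbf{1}=(1,\ldots,1)$; (iv) for each block of $A$ there is at least one index $i$ in the block for which the $i$-th entry of $\mathbf{1}^TA^{-1}$ is strictly positive. *)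

(* Defs.v *)
From HB Require Import structures.
From mathcomp Require Import all_boot all_order all_algebra.
From mathcomp Require Import all_classical all_reals all_analysis.
Set Implicit Arguments.
Unset Strict Implicit.
Unset Printing Implicit Defensive.
Import Order.TTheory GRing.Theory Num.Theory.
Import numFieldNormedType.Exports.
Local Open Scope classical_set_scope.
Local Open Scope ring_scope.

Definition posdefmx (R : realType) (n : nat) (A : 'M[R]_n) : Prop :=
  A^T = A /\ forall v : 'rV[R]_n, v != 0 -> 0 < (v *m A *m v^T) 0 0.

(* Integral over R^n with respect to Lebesgue measure, as an iterated
   one-dimensional integral (Tonelli): it is only meant for nonnegative
   measurable integrands. *)
Fixpoint tuple_integral (R : realType) (n : nat) :
    (n.-tuple R -> \bar R) -> \bar R :=
  match n return (n.-tuple R -> \bar R) -> \bar R with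
  | 0 => fun f => f [tuple]
  | m.+1 => fun f =>
      (\int[@lebesgue_measure R]_x
         tuple_integral (fun t : m.-tuple R => f (cons_tuple x t)))%E
  end.

Definition gaussian_pdf (R : realType) (n : nat) (A : 'M[R]_n)
    (x : 'rV[R]_n) : R :=
  expR (- (x *m invmx A *m x^T) 0 0 / 2) / Num.sqrt ((2 * pi) ^+ n * \det A).

(* X ~ N(0, A), A positive definite: the joint law of X has density
   gaussian_pdf A with respect to Lebesgue measure on R^n. *)
Definition gaussian_vector (d : measure_display) (T : measurableType d)
    (R : realType) (P : probability T R) (n : nat)
    (X : 'I_n -> {RV P >-> R}) (A : 'M[R]_n) : Prop :=
  posdefmx A /\
  forall D : set (n.-tuple R), measurable D ->
    P [set w | D [tuple X i w | i < n]] =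
    tuple_integral (fun x =>
      (\1_D x * gaussian_pdf A (\row_i tnth x i))%:E).

Definition standard (d : measure_display) (T : measurableType d)
    (R : realType) (P : probability T R) (n : nat)
    (X : 'I_n -> {RV P >-> R}) : Prop :=
  forall i, ('E_P[X i] = 0)%E /\ 'V_P[X i] = 1%E.

(* "Block diagonal up to a permutation of the index set" is expressed by the
   partition Q of the index set into (the index sets of) the blocks. *)
Definition dgff_covariance (R : realType) (n : nat) (A : 'M[R]_n) : Prop :=
  let oneAV : 'rV[R]_n := const_mx 1 *m invmx A in
  exists Q : {set {set 'I_n}},
    finset.partition Q [set: 'I_n]%SET /\
    [/\ (forall i j, j \in finset.pblock Q i -> 0 < A i j) /\
        (forall i j, j \notin finset.pblock Q i -> A i j = 0),
        (forall i j, i != j -> invmx A i j <= 0),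
        (forall i, 0 <= oneAV 0 i) &
        (forall B, B \in Q -> exists2 i, i \in B & 0 < oneAV 0 i)].

Definition dgff (d : measure_display) (T : measurableType d)
    (R : realType) (P : probability T R) (n : nat)
    (X : 'I_n -> {RV P >-> R}) : Prop :=
  exists2 A : 'M[R]_n, gaussian_vector X A & dgff_covariance A.

(* Given the partition pi, a colouring of its elements is encoded by the set
   C of the elements that get the value 1; it produces the configuration y iff
   the union of C is the set of the i with y i = 1. *)
Definition coloring_prob (R : realType) (S : finType) (p : R)
    (pi : {set {set S}}) (y : {ffun S -> bool}) : R :=
  \sum_(C in powerset pi | finset.cover C == [set i | y i]%SET)
    p ^+ #|C| * (1 - p) ^+ #|(pi :\: C)%SET|.

(* The law of a random partition of the finite set S. *)
Definition partition_law (R : realType) (S : finType)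
    (q : {set {set S}} -> R) : Prop :=
  [/\ (forall pi, 0 <= q pi),
      (forall pi, ~~ finset.partition pi [set: S]%SET -> q pi = 0) &
      \sum_pi q pi = 1].

Definition color_process (d : measure_display) (T : measurableType d)
    (R : realType) (P : probability T R) (S : finType)
    (Y : S -> T -> bool) : Prop :=
  exists (p : R) (q : {set {set S}} -> R),
    [/\ 0 <= p <= 1, partition_law q &
        forall y : {ffun S -> bool},
          P [set w | forall i, Y i w = y i] =
          (\sum_pi q pi * coloring_prob p pi y)%:E].

Definition threshold (d : measure_display) (T : measurableType d)
    (R : realType) (P : probability T R) (n : nat)
    (X : 'I_n -> {RV P >-> R}) (h : R) (i : 'I_n) (w : T) : bool :=
  h < X i w.

(* Main.v *)
Require Import Defs.
From HB Require Import structures.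
From mathcomp Require Import all_boot all_order all_algebra.
From mathcomp Require Import ring lra zify.
Set Implicit Arguments.
Unset Strict Implicit.
Unset Printing Implicit Defensive.
Import Order.TTheory GRing.Theory Num.Theory.
Local Open Scope ring_scope.

(** The idea is to guess an explicit random partition for large [h]. Given a set
    [U], cut each block [B] of the covariance into the single element [U :&: B]
    and the singletons of [B :\: U]. For a mixture of the colorings of these
    partitions with product weights, the central moments
    [E \prod_(i in W) (Y_i - p)] factor over the blocks, and on one block they
    form a triangular system in the weights which Moebius inversion solves in
    closed form. A law on subsets is determined by its central moments, so only
    the nonnegativity of the resulting weights is at stake.

    Write [nu S] for the probability that all [X_i], [i] in [S], exceed [h], and
    [e S] for the minimum of [x A^-1 x^T] over the [x] equal to [1] on [S]. Then
    [nu S <= exp (- h^2 e S / 2)], while the event that exactly the coordinates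
    in [S] exceed [h] has probability at least
    [c exp (- h^2 e S / 2 - C h)]. The conditions on [A^-1] give a maximum
    principle, from which [e S < e S' + #|S :\: S'| / a] whenever [S'] is a
    nonempty proper subset of [S] and [S] lies in a block ([a] being the common
    variance). Hence, up to a factor which tends to [1], the weight of [V] is
    [p^-1] times the probability that exactly [V] exceeds [h] in its block. *)

(** * Central moments and mixtures of colorings *)

Section SubsetSums.
Variables (R : comPzRingType) (I : finType).
Implicit Types A B S V W U D : {set I}.

Lemma prodrD_subsets W (F G : I -> R) :
  \prod_(i in W) (F i + G i) =
  \sum_(S : {set I} | S \subset W)
    (\prod_(i in S) F i) * \prod_(i in W :\: S) G i.
Proof.
rewrite big_mkcond/=.
(* Off [W] the summands become 0 and 1, so that the expansion over all sets keeps exactly the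
   subsets of [W]. *)
pose F' i := if i \in W then F i else 0.
pose G' i := if i \in W then G i else 1.
rewrite (eq_bigr (fun i => F' i + G' i)); last first.
  by move=> i _; rewrite /F' /G'; case: ifP => // _; rewrite add0r.
rewrite bigA_distr [RHS]big_mkcond/=; apply: eq_bigr => S _.
case: ifPn => [/subsetP SW|/subsetPn[i iS iW]]; last first.
  by rewrite (bigD1 i)//= iS /F' (negbTE iW) mul0r.
rewrite (bigID (mem S))/=; congr (_ * _).
  by apply: eq_bigr => i iS; rewrite iS /F' SW.
rewrite [RHS]big_mkcond [LHS]big_mkcond/=; apply: eq_bigr => i _.
by rewrite inE /G'; case: (i \in S) => //=; case: (i \in W).
Qed.

(** The sum is the expansion of the product over [B] of [-1 + (i \notin A)], which has a zero factor
    as soon as [B] has a point outside [A]. *)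
Lemma sum_sign_interval A B : A \subset B ->
  \sum_(V : {set I} | (A \subset V) && (V \subset B)) (-1) ^+ #|V| =
  (A == B)%:R * (-1) ^+ #|A| :> R.
Proof.
move=> AB.
transitivity (\prod_(i in B) (-1 + (i \notin A)%:R : R)).
  rewrite prodrD_subsets [RHS](bigID (fun V => A \subset V))/=.
  rewrite [X in _ = _ + X]big1 ?addr0; last first.
    move=> V /andP[VB /subsetPn[i iA iV]]; rewrite [X in _ * X](bigD1 i)/=.
      by rewrite iA mul0r mulr0.
    by rewrite inE iV (subsetP AB).
  apply: eq_big => [V|V /andP[AV _]]; first by rewrite andbC.
  rewrite prodr_const big1 ?mulr1// => i; rewrite inE => /andP[iV _].
  by rewrite (contra (subsetP AV i) iV).
have [->|nAB] := eqVneq A B.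
  rewrite mul1r -prodr_const; apply: eq_bigr => i iB.
  by rewrite iB addr0.
rewrite mul0r; have /subsetPn[i iB iA] : ~~ (B \subset A).
  by apply: contra nAB => BA; rewrite eqEsubset AB.
by rewrite (bigD1 i)//= iA addNr mul0r.
Qed.

Lemma sum_subsets_prod_partition (Q : {set {set I}}) D
    (F : {set I} -> {set I} -> R) : partition Q D ->
  \sum_(U : {set I} | U \subset D) \prod_(B in Q) F B (U :&: B) =
  \prod_(B in Q) \sum_(V : {set I} | V \subset B) F B V.
Proof.
move=> partQ; have [/eqP covQ trivQ _] := and3P partQ.
rewrite (big_distr_big_dep set0)/=.
(* [h] and [h'] are inverse bijections between the subsets of [D] and the choices of one subset in
   each block; outside [Q] a choice takes the default value [set0]. *)
pose h (U : {set I}) : {ffun {set I} -> {set I}} :=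
  [ffun B => if B \in Q then U :&: B else set0].
pose h' (f : {ffun {set I} -> {set I}}) := \bigcup_(B in Q) f B.
rewrite (reindex_onto h h')/=; last first.
  move=> f /pfamilyP[fQ fB]; apply/ffunP => B; rewrite ffunE.
  case: ifPn => BQ; last first.
    by apply/esym/eqP; apply: contraNT BQ => fBn; exact: (subsetP fQ).
  apply/setP => i; rewrite inE; apply/andP/idP => [[]|ifB].
    case/bigcupP => B' B'Q ifB' iB.
    suff -> : B = B' by [].
    have iB' : i \in B' by apply: subsetP ifB'; exact: fB.
    by rewrite -(def_pblock trivQ BQ iB) -(def_pblock trivQ B'Q iB').
  split; first by apply/bigcupP; exists B.
  by apply: subsetP ifB; exact: fB.
apply: eq_big => [U|U UD]; last first.
  by apply: eq_bigr => B BQ; rewrite ffunE BQ.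
have h'hU : h' (h U) = U :&: D.
  rewrite /h' (eq_bigr (fun B => U :&: B)); last by move=> B BQ; rewrite ffunE BQ.
  by rewrite -covQ /cover; apply/setP => i; rewrite inE; apply/bigcupP/andP;
    [case=> B BQ; rewrite inE => /andP[-> iB]; split=> //; apply/bigcupP; exists B
    |case=> iU /bigcupP[B BQ iB]; exists B; rewrite // inE iU].
rewrite h'hU; have -> : (U \subset D) = (U :&: D == U).
  by apply/idP/eqP => [/setIidPl//|/setIidPl].
case: eqP => _; rewrite ?andbT ?andbF//; apply/esym/pfamilyP; split.
  by apply/subsetP => B; rewrite !inE ffunE; case: ifP => //; rewrite eqxx.
by move=> B BQ; rewrite ffunE BQ unfold_in/= subsetIr.
Qed.

End SubsetSums.

(** * Central moments of a law on subsets *)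

Section CentralMoments.
Variables (R : realFieldType) (I : finType) (p : R).
Implicit Types (mu : {set I} -> R) (Q : {set {set I}}) (B S V W U Z : {set I}).

(** For [mu] the law of the random set of ones, this is the probability of seeing only ones on
    [S]. *)
Definition upper_sum mu S := \sum_(Z : {set I} | S \subset Z) mu Z.

Definition central_moment mu W :=
  \sum_Z mu Z * \prod_(i in W) ((i \in Z)%:R - p).

(* The [m]-th central moment of a Bernoulli variable with mean [p]. *)
Definition bernoulli_moment m : R := p * (1 - p) ^+ m + (1 - p) * (- p) ^+ m.

Lemma bernoulli_moment0 : bernoulli_moment 0 = 1.
Proof. by rewrite /bernoulli_moment !expr0 !mulr1; ring. Qed.

Lemma bernoulli_moment1 : bernoulli_moment 1 = 0.
Proof. by rewrite /bernoulli_moment !expr1; ring. Qed.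

Lemma central_momentE mu W : central_moment mu W =
  \sum_(S : {set I} | S \subset W) (- p) ^+ #|W :\: S| * upper_sum mu S.
Proof.
rewrite /central_moment.
under eq_bigr do rewrite prodrD_subsets big_distrr/=.
rewrite exchange_big/=; apply: eq_bigr => S SW.
rewrite /upper_sum big_distrr/= [RHS]big_mkcond/=; apply: eq_bigr => Z _.
rewrite prodr_const; case: ifPn => [/subsetP SZ|/subsetPn[i iS iZ]].
  by rewrite big1 ?mul1r 1?mulrC// => i /SZ ->.
by rewrite (bigD1 i)//= (negbTE iZ) !mul0r mulr0.
Qed.

(** At each site the indicator of agreeing with [Y] is affine in the centered variable, with slope
    [F i] and constant term [G i]. Multiplying over the sites writes every point mass as one fixed
    linear combination of central moments. *)
Lemma central_moment_inj mu mu' :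
  central_moment mu =1 central_moment mu' -> mu =1 mu'.
Proof.
move=> eq_mu Y.
pose F (i : I) : R := if i \in Y then 1 else - 1.
pose G (i : I) : R := if i \in Y then p else 1 - p.
have indic Z : (Z == Y)%:R =
    \sum_(W : {set I}) (\prod_(i in W) F i * \prod_(i in ~: W) G i) *
      \prod_(i in W) ((i \in Z)%:R - p).
  transitivity (\prod_(i in [set: I]) (F i * ((i \in Z)%:R - p) + G i)).
    have [->|nZY] := eqVneq Z Y.
      rewrite big1// => i _; rewrite /F /G; case: (i \in Y) => /=; ring.
    have [i iZY] : exists i, (i \in Z) != (i \in Y).
      apply/existsP; apply: contraR nZY; rewrite negb_exists => /forallP h.
      by apply/eqP/setP => i; apply/eqP; rewrite -[_ == _]negbK.
    rewrite (bigD1 i)/=; last by rewrite inE.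
    rewrite [X in X * _](_ : _ = 0) ?mul0r// /F /G; move: iZY.
    by case: (i \in Z); case: (i \in Y); rewrite ?eqxx //= => _; ring.
  rewrite prodrD_subsets; apply: eq_big => [W|W _]; first by rewrite subsetT.
  by rewrite big_split/= setTD mulrAC.
have muE m : m Y = \sum_(W : {set I})
    (\prod_(i in W) F i * \prod_(i in ~: W) G i) * central_moment m W.
  transitivity (\sum_Z m Z * (Z == Y)%:R).
    rewrite (bigD1 Y)//= eqxx mulr1 big1 ?addr0// => Z /negbTE ->.
    by rewrite mulr0.
  under eq_bigr do rewrite indic big_distrr/=.
  rewrite exchange_big/=; apply: eq_bigr => W _.
  by rewrite /central_moment big_distrr/=; apply: eq_bigr => Z _; ring.
by rewrite muE [RHS]muE; apply: eq_bigr => W _; rewrite eq_mu.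
Qed.

(** Each block is only assumed independent of its complement; splitting off the blocks one after
    another gives their joint independence. *)
Lemma upper_sum_prod mu Q S (s : seq {set I}) :
  trivIset Q -> uniq s -> {subset s <= Q} ->
  upper_sum mu finset.set0 = 1 ->
  (forall B T, B \in Q ->
    upper_sum mu T = upper_sum mu (T :&: B) * upper_sum mu (T :\: B)) ->
  upper_sum mu (S :&: \bigcup_(B <- s) B) =
  \prod_(B <- s) upper_sum mu (S :&: B).
Proof.
move=> trivQ us sQ mu0 indep; elim: s us sQ => [|B s IH]/=.
  by rewrite !big_nil setI0.
move=> /andP[Bs us] sQ; rewrite !big_cons (indep B); last first.
  by rewrite sQ ?mem_head.
rewrite -IH//; last by move=> C Cs; rewrite sQ// inE Cs orbT.
have disjB : B :&: \bigcup_(C <- s) C = finset.set0.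
  apply/setP => i; rewrite !inE; apply/negP => /andP[iB].
  rewrite (bigcup_seq s) => /bigcupP[C Cs iC].
  have BQ : B \in Q by rewrite sQ ?mem_head.
  have CQ : C \in Q by rewrite sQ// inE Cs orbT.
  move: Bs; rewrite -(def_pblock trivQ BQ iB) (def_pblock trivQ CQ iC).
  by rewrite Cs.
congr (upper_sum mu _ * upper_sum mu _).
  by rewrite -setIA; congr (_ :&: _); rewrite setIC setIUr setIid disjB setU0.
rewrite setDE -setIA; congr (_ :&: _); rewrite -setDE setDUl setDv finset.set0U.
by apply/setDidPl; rewrite -setI_eq0 setIC disjB.
Qed.

Lemma central_moment_prod mu Q W : partition Q [set: I] ->
  upper_sum mu finset.set0 = 1 ->
  (forall B T, B \in Q ->
    upper_sum mu T = upper_sum mu (T :&: B) * upper_sum mu (T :\: B)) ->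
  central_moment mu W = \prod_(B in Q) central_moment mu (W :&: B).
Proof.
move=> partQ mu0 indep; have [/eqP covQ trivQ _] := and3P partQ.
have cupQ : \bigcup_(B <- enum Q) B = [set: I].
  by rewrite big_enum.
have upE S : upper_sum mu S = \prod_(B in Q) upper_sum mu (S :&: B).
  rewrite -[in LHS](setIT S) -cupQ (upper_sum_prod _ trivQ) ?enum_uniq//.
    by rewrite big_enum.
  by move=> B; rewrite mem_enum.
have cardE (S : {set I}) : #|S| = (\sum_(B in Q) #|S :&: B|)%N.
  rewrite -sum1_card; under [RHS]eq_bigr do rewrite -sum1_card.
  transitivity (\sum_(B in Q) \sum_(i in B | i \in S) 1)%N; last first.
    by apply: eq_bigr => B _; apply: eq_bigl => i; rewrite inE andbC.
  by rewrite -(set_partition_big_cond _ partQ); apply: eq_bigl => i; rewrite inE.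
(* The term of [central_momentE] inside one block, set to 0 unless [V] lies in [W], so that the sum
   may run over all subsets. *)
pose F B V := if V \subset W then (- p) ^+ #|(W :&: B) :\: V| * upper_sum mu V
              else 0.
transitivity (\sum_(U : {set I} | U \subset [set: I]) \prod_(B in Q) F B (U :&: B)).
  rewrite central_momentE big_mkcond/= [RHS](eq_bigl xpredT); last first.
    by move=> U; rewrite subsetT.
  apply: eq_bigr => S _; case: ifPn => [SW|/subsetPn[i iS iW]].
    rewrite upE cardE -prodrXr -big_split/=; apply: eq_bigr => B _.
    rewrite /F (subset_trans (subsetIl _ _) SW); congr ((- p) ^+ #|pred_of_set _| * _).
    apply/setP => i; rewrite !inE.
    by case: (i \in S); case: (i \in B); rewrite /= ?andbF ?andbT.
  have iT : i \in cover Q by rewrite covQ inE.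
  case/bigcupP : iT => B BQ iB; rewrite (bigD1 B)//= /F ifN ?mul0r//.
  by apply/subsetPn; exists i; rewrite // inE iS.
rewrite (sum_subsets_prod_partition F partQ); apply: eq_bigr => B BQ.
rewrite central_momentE [RHS]big_mkcond [LHS]big_mkcond/=.
apply: eq_bigr => V _; rewrite /F subsetI.
by case: (V \subset W); case: (V \subset B).
Qed.

End CentralMoments.

(** * Moebius inversion inside one block *)

Section BlockWeights.
Variables (R : realFieldType) (I : finType) (p : R) (mu : {set I} -> R).
Implicit Types (B S V W U Z : {set I}).

(* Moebius inversion, over the subsets of [B], of
   [\sum_(V | W \subset V) w V = central_moment W / bernoulli_moment #|W|]. *)
Definition inverted_moment B V :=
  \sum_(W : {set I} | (V \subset W) && (W \subset B))
    (-1) ^+ (#|W| + #|V|) *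
    (central_moment p mu W / bernoulli_moment p #|W|).

(* Sets with at most one element all induce the partition into singletons, so
   the complementary mass may be put on the empty set. *)
Definition block_weight B V :=
  if (1 < #|V|)%N then inverted_moment B V
  else if V == finset.set0 then
    1 - \sum_(V' : {set I} | (V' \subset B) && (1 < #|V'|)%N)
          inverted_moment B V'
  else 0.

(** Three regimes: for the empty set this is the normalization that fixes the weight of [set0]; for
    a singleton both sides vanish, the first central moment being 0; for larger sets it is Moebius
    inversion. *)
Lemma block_weight_moment B W : W \subset B ->
  (forall m, (1 < m)%N -> bernoulli_moment p m != 0) ->
  (forall i, central_moment p mu [set i] = 0) ->
  central_moment p mu finset.set0 = 1 ->
  (\sum_(V : {set I} | (W \subset V) && (V \subset B)) block_weight B V) *
    bernoulli_moment p #|W| = central_moment p mu W.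
Proof.
move=> WB bern_neq0 moment1 moment0.
have [W0|W1|W2] : [\/ W = finset.set0, exists i, W = [set i] | (1 < #|W|)%N].
- case: (ltnP 1 #|W|) => [|W1]; first by constructor 3.
  have [/eqP/cards1P|W0] := eqVneq #|W| 1%N; first by constructor 2.
  by constructor 1; apply: cards0_eq; move: W1 W0; case: #|W| => [|[]].
- rewrite W0 cards0 bernoulli_moment0 mulr1 moment0.
  rewrite (eq_bigl (fun V => V \subset B)); last by move=> V; rewrite finset.sub0set.
  rewrite (bigID (fun V : {set I} => (1 < #|V|)%N))/=.
  rewrite [X in _ + X](bigD1 finset.set0)/=; last first.
    by rewrite finset.sub0set cards0.
  rewrite [X in _ + (_ + X)]big1 ?addr0; last first.
    move=> V /andP[/andP[_ V1] V0].
    by rewrite /block_weight (negbTE V1) (negbTE V0).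
  rewrite [X in _ + X]/block_weight cards0/= eqxx.
  rewrite (eq_bigr (inverted_moment B)); first by ring.
  by move=> V /andP[_ V1]; rewrite /block_weight V1.
- case: W1 WB => i -> _.
  by rewrite cards1 bernoulli_moment1 mulr0 moment1.
rewrite (eq_bigr (inverted_moment B)); last first.
  move=> V /andP[WV _]; rewrite /block_weight ifT//.
  by apply: leq_trans W2 _; exact: subset_leq_card.
rewrite -[RHS](divfK (bern_neq0 _ W2)); congr (_ * _).
pose r W' := central_moment p mu W' / bernoulli_moment p #|W'|.
(* After exchanging the sums, the inner alternating sum runs over an interval of sets and vanishes
   unless [W' = W]. *)
transitivity (\sum_(W' : {set I} | W' \subset B)
  \sum_(V : {set I} | (W \subset V) && (V \subset W'))
     (-1) ^+ #|V| * ((-1) ^+ #|W'| * r W')).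
  under eq_bigr do rewrite /inverted_moment big_mkcond/=.
  rewrite exchange_big/= [RHS]big_mkcond/=; apply: eq_bigr => W' _.
  case: ifPn => W'B; last first.
    by rewrite big1// => V _; rewrite andbF.
  rewrite big_mkcond [RHS]big_mkcond/=; apply: eq_bigr => V _.
  rewrite andbT; case: (W \subset V) => //=.
  have [VW'|] := boolP (V \subset W'); last by rewrite if_same.
  by rewrite (subset_trans VW' W'B) exprD -mulrA mulrCA.
rewrite (bigD1 W)//= -big_distrl/= sum_sign_interval// eqxx mul1r.
rewrite mulrA -exprD addnn -mul2n exprM sqrrN expr1n expr1n mul1r.
rewrite big1 ?addr0// => W' /andP[W'B nW].
have [WW'|nWW'] := boolP (W \subset W').
  by rewrite -big_distrl/= sum_sign_interval// eq_sym (negbTE nW) !mul0r.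
rewrite big_pred0// => V; apply/negP => /andP[WV VW'].
by move: nWW'; rewrite (subset_trans WV).
Qed.

End BlockWeights.

(** * Moments of colorings and of their mixtures *)

Section Coloring.
Variables (R : realFieldType) (I : finType) (p : R).
Implicit Types (B S V W U Z : {set I}) (Q pi : {set {set I}}).

(** This is [coloring_prob] with the configuration encoded by the set of its ones, to match laws on
    subsets. *)
Definition coloring_law pi Z : R :=
  \sum_(C in powerset pi | cover C == Z)
    p ^+ #|C| * (1 - p) ^+ #|(pi :\: C)%SET|.

(** The elements of [pi] are colored independently, and all points of [W :&: b] share one Bernoulli
    variable. *)
Lemma coloring_moment pi W : partition pi [set: I] ->
  central_moment p (coloring_law pi) W =
  \prod_(b in pi) bernoulli_moment p #|W :&: b|.
Proof.
move=> partpi; have [/eqP covpi trivpi _] := and3P partpi.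
transitivity (\sum_(C in powerset pi) p ^+ #|C| * (1 - p) ^+ #|(pi :\: C)%SET| *
   \prod_(i in W) ((i \in cover C)%:R - p)).
  rewrite /central_moment /coloring_law.
  under eq_bigr do rewrite big_distrl/= big_mkcondr/=.
  rewrite exchange_big/=; apply: eq_bigr => C _.
  rewrite (bigD1 (cover C))//= eqxx [X in _ + X]big1 ?addr0// => Z.
  by rewrite eq_sym => /negbTE ->.
rewrite prodrD_subsets.
apply: eq_big => [C|C]; first by rewrite powersetE.
rewrite powersetE => Cpi.
have -> : \prod_(i in W) ((i \in cover C)%:R - p) =
    \prod_(b in pi) ((b \in C)%:R - p) ^+ #|W :&: b|.
  rewrite (eq_bigl (fun i => (i \in [set: I]) && (i \in W))); last first.
    by move=> i; rewrite inE.
  rewrite (set_partition_big_cond _ partpi)/=; apply: eq_bigr => b bpi.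
  rewrite -prodr_const; apply: eq_big => [i|i /andP[ib _]].
    by rewrite inE andbC.
  congr (_%:R - _); congr (nat_of_bool _); apply/idP/idP => [/bigcupP[b' b'C ib']|bC].
    by rewrite -(def_pblock trivpi bpi ib) (def_pblock trivpi _ ib') ?(subsetP Cpi).
  by apply/bigcupP; exists b.
have split_pi (F : {set I} -> R) :
    \prod_(b in pi) F b = (\prod_(b in C) F b) * \prod_(b in pi :\: C) F b.
  rewrite (bigID (mem C))/=; congr (_ * _); apply: eq_bigl => b.
    by apply/andP/idP => [[]//|bC]; rewrite bC (subsetP Cpi).
  by rewrite inE andbC.
rewrite split_pi mulrACA -!prodr_const -!big_split/=; congr (_ * _).
  by apply: eq_bigr => b bC; rewrite bC.
by apply: eq_bigr => b; rewrite inE => /andP[/negbTE -> _]; rewrite sub0r.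
Qed.

Definition trace_partition Q U : {set {set I}} :=
  [set U :&: B | B in Q & U :&: B != finset.set0] :|: [set [set i] | i in ~: U].

Lemma trace_partitionP Q U :
  partition Q [set: I] -> partition (trace_partition Q U) [set: I].
Proof.
move=> partQ; have [/eqP covQ trivQ _] := and3P partQ.
apply/and3P; split.
- rewrite -finset.subTset; apply/subsetP => i _; apply/bigcupP.
  have [iU|iU] := boolP (i \in U).
    have iT : i \in cover Q by rewrite covQ inE.
    have iB : i \in U :&: pblock Q i by rewrite inE iU mem_pblock.
    exists (U :&: pblock Q i) => //; rewrite inE; apply/orP; left.
    apply/imsetP; exists (pblock Q i) => //; rewrite inE pblock_mem//=.
    by apply/set0Pn; exists i.
  exists [set i]; last by rewrite inE.
  by rewrite inE; apply/orP; right; apply/imsetP; exists i; rewrite // inE.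
- apply/trivIsetP => A B; rewrite !inE.
  move=> /orP[/imsetP[A']|/imsetP[i]]; rewrite inE.
    move=> /andP[A'Q _] ->.
    move=> /orP[/imsetP[B']|/imsetP[j]]; rewrite inE.
      move=> /andP[B'Q _] -> neq.
      have nA'B' : A' != B' by apply: contraNneq neq => ->.
      move/trivIsetP: trivQ => /(_ _ _ A'Q B'Q nA'B').
      rewrite -!setI_eq0 => /eqP d; apply/eqP/setP => k; rewrite !inE.
      by move/setP/(_ k): d; rewrite !inE; case: (k \in U) => //=.
    move=> jU -> _; rewrite disjoint_sym disjoints1 inE.
    by rewrite (negbTE jU).
  move=> iU ->.
  move=> /orP[/imsetP[B']|/imsetP[j]]; rewrite inE.
    by move=> _ -> _; rewrite disjoints1 inE (negbTE iU).
  by move=> jU -> neq; rewrite disjoints1 inE; apply: contraNneq neq => ->.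
- rewrite !inE negb_or; apply/andP; split; apply/imsetP => -[x].
    by rewrite inE => /andP[_ /negbTE h] e; rewrite -e eqxx in h.
  by move=> _ /setP/(_ x); rewrite !inE eqxx.
Qed.

(** A point of [W] outside [U] forms a singleton of the partition and contributes a first central
    moment, which is 0. If [W] lies in [U], only the traces [U :&: B] can meet [W]. *)
Lemma trace_partition_moment Q U W : partition Q [set: I] ->
  central_moment p (coloring_law (trace_partition Q U)) W =
  (W \subset U)%:R * \prod_(B in Q) bernoulli_moment p #|W :&: B|.
Proof.
move=> partQ; have [/eqP covQ trivQ _] := and3P partQ.
rewrite coloring_moment; last exact: trace_partitionP.
have [WU|/subsetPn[i iW iU]] := boolP (W \subset U); last first.
  rewrite mul0r (bigD1 [set i])/=; last first.
    by rewrite inE; apply/orP; right; apply/imsetP; exists i; rewrite // inE.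
  rewrite (_ : W :&: [set i] = [set i]) ?cards1 ?bernoulli_moment1 ?mul0r//.
  by apply/setIidPr; rewrite finset.sub1set.
rewrite mul1r (eq_bigl [predU [set U :&: B | B in Q & U :&: B != finset.set0]
    & [set [set i] | i in ~: U]]); last by move=> b; rewrite !inE.
rewrite bigU/=; last first.
  rewrite -setI_eq0; apply/eqP/setP => b; rewrite !inE; apply/negP.
  move=> /andP[/imsetP[B _ ->] /imsetP[i]].
  by rewrite inE => iU /setP/(_ i); rewrite !inE eqxx (negbTE iU).
rewrite [X in _ * X]big1 ?mulr1; last first.
  move=> b /imsetP[i]; rewrite inE => iU ->.
  rewrite (_ : W :&: [set i] = finset.set0) ?cards0 ?bernoulli_moment0//.
  apply/eqP; rewrite setI_eq0 disjoint_sym disjoints1.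
  by apply: contra iU; exact: (subsetP WU).
rewrite big_imset/=; last first.
  move=> B B'; rewrite !inE => /andP[BQ /set0Pn[i]] + /andP[B'Q _] e.
  move=> iUB; have := iUB; rewrite e inE => /andP[_ iB'].
  move: iUB; rewrite inE => /andP[_ iB].
  by rewrite -(def_pblock trivQ BQ iB) (def_pblock trivQ B'Q iB').
rewrite [RHS](bigID (fun B => U :&: B != finset.set0))/=.
rewrite [X in _ = _ * X]big1 ?mulr1; last first.
  move=> B /andP[_]; rewrite negbK => /eqP UB0.
  rewrite (_ : W :&: B = finset.set0) ?cards0 ?bernoulli_moment0//.
  by apply/eqP; rewrite -finset.subset0 -UB0 finset.setSI.
apply: eq_big => [B|B _]; first by rewrite inE.
by rewrite setIA (setIidPl WU).
Qed.

Lemma central_moment_set0 (mu : {set I} -> R) :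
  central_moment p mu finset.set0 = upper_sum mu finset.set0.
Proof.
rewrite central_momentE (bigD1 finset.set0)//= finset.setD0 cards0 mul1r.
by rewrite big1 ?addr0// => S /andP[]; rewrite finset.subset0 => ->.
Qed.

Lemma central_moment_set1 (mu : {set I} -> R) i :
  upper_sum mu finset.set0 = 1 -> upper_sum mu [set i] = p ->
  central_moment p mu [set i] = 0.
Proof.
move=> mu0 mu1.
rewrite central_momentE (bigD1 finset.set0) ?finset.sub0set//=.
rewrite finset.setD0 cards1 expr1 mu0 (bigD1 [set i])/=; last first.
  by rewrite subxx/=; apply/set0Pn; exists i; rewrite inE.
rewrite setDv cards0 mul1r mu1 big1 ?addr0; first by ring.
by move=> S; rewrite finset.subset1 => /andP[/andP[/orP[->//|->]]].
Qed.

(** By [central_moment_inj] it is enough to compare central moments. Both sides factor over the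
    blocks, and in each block the equation is [block_weight_moment]. *)
Lemma trace_mixture (mu : {set I} -> R) Q Z : partition Q [set: I] ->
  upper_sum mu finset.set0 = 1 ->
  (forall B T, B \in Q ->
    upper_sum mu T = upper_sum mu (T :&: B) * upper_sum mu (T :\: B)) ->
  (forall m, (1 < m)%N -> bernoulli_moment p m != 0) ->
  (forall i, upper_sum mu [set i] = p) ->
  \sum_U (\prod_(B in Q) block_weight p mu B (U :&: B)) *
    coloring_law (trace_partition Q U) Z = mu Z.
Proof.
move=> partQ mu0 indep bern mu1; move: Z; apply: (@central_moment_inj R I p) => W.
transitivity (\sum_U (\prod_(B in Q) block_weight p mu B (U :&: B)) *
    ((W \subset U)%:R * \prod_(B in Q) bernoulli_moment p #|W :&: B|)).
  rewrite /central_moment/=; under eq_bigr => Z _ do rewrite big_distrl/=.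
  rewrite exchange_big/=; apply: eq_bigr => U _.
  rewrite -trace_partition_moment// /central_moment big_distrr/=.
  by apply: eq_bigr => Z' _; rewrite mulrA.
rewrite (central_moment_prod p W partQ)//.
under [LHS]eq_bigr => U _ do rewrite mulrA.
rewrite -big_distrl/=.
(* The indicator of [W \subset U] is itself a product over the blocks, hence can be absorbed in the
   block factors. *)
have -> : \sum_U (\prod_(B in Q) block_weight p mu B (U :&: B)) *
      (W \subset U)%:R =
    \sum_(U : {set I} | U \subset [set: I]) \prod_(B in Q)
       ((W :&: B \subset U :&: B)%:R * block_weight p mu B (U :&: B)).
  rewrite [RHS](eq_bigl xpredT); last by move=> U; rewrite subsetT.
  apply: eq_bigr => U _; rewrite big_split/= mulrC; congr (_ * _).
  have [WU|/subsetPn[i iW iU]] := boolP (W \subset U).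
    by rewrite big1// => B _; rewrite finset.setSI.
  have iT : i \in cover Q by rewrite (cover_partition partQ) inE.
  case/bigcupP : iT => B BQ iB; rewrite (bigD1 B)//= (_ : _ \subset _ = false) ?mul0r//.
  by apply/negbTE/subsetPn; exists i; rewrite inE ?iW ?iB// (negbTE iU).
rewrite (sum_subsets_prod_partition
  (fun B V => (W :&: B \subset V)%:R * block_weight p mu B V) partQ).
rewrite -big_split/=; apply: eq_bigr => B BQ.
rewrite -(block_weight_moment (B := B)) ?finset.subsetIr ?central_moment_set0//; last first.
  by move=> i; rewrite central_moment_set1.
congr (_ * _).
rewrite [RHS]big_mkcond [LHS]big_mkcond/=; apply: eq_bigr => V _.
by case: (_ \subset V); rewrite ?mul1r ?mul0r//= if_same.
Qed.

(** The sum is the product over the blocks of the left side of [block_weight_moment] for the empty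
    set. *)
Lemma sum_block_weight (mu : {set I} -> R) Q : partition Q [set: I] ->
  upper_sum mu finset.set0 = 1 ->
  (forall m, (1 < m)%N -> bernoulli_moment p m != 0) ->
  (forall i, upper_sum mu [set i] = p) ->
  \sum_U (\prod_(B in Q) block_weight p mu B (U :&: B)) = 1.
Proof.
move=> partQ mu0 bern mu1.
transitivity (\sum_(U : {set I} | U \subset [set: I])
    \prod_(B in Q) block_weight p mu B (U :&: B)).
  by apply: eq_bigl => U; rewrite subsetT.
rewrite (sum_subsets_prod_partition _ partQ) big1// => B _.
transitivity ((\sum_(V : {set I} | (finset.set0 \subset V) && (V \subset B))
    block_weight p mu B V) * bernoulli_moment p #|@finset.set0 I|).
  rewrite cards0 bernoulli_moment0 mulr1.
  by apply: eq_bigl => V; rewrite finset.sub0set.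
rewrite block_weight_moment ?finset.sub0set ?central_moment_set0//.
by move=> i; rewrite central_moment_set1.
Qed.

End Coloring.

(** * Nonnegativity of the weights *)

Section Positivity.
Variables (R : realFieldType) (I : finType) (p eps : R) (mu : {set I} -> R).
Implicit Types (B S V W U Z : {set I}).

Hypothesis mu_ge0 : forall Z, 0 <= mu Z.
Hypothesis mu_total : upper_sum mu finset.set0 = 1.
Hypothesis mu_marginal : forall i, upper_sum mu [set i] = p.
Hypotheses (p_gt0 : 0 < p) (p_le : p <= eps).

(** [K] bounds the number of terms of any sum over subsets, and also every cardinality plus one. *)
Local Notation K := (2 ^+ #|I| : R).
Hypothesis eps_le : 4 * K ^+ 3 * eps <= 1.

Lemma upper_sum_ge0 S : 0 <= upper_sum mu S.
Proof. by rewrite sumr_ge0. Qed.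

Lemma upper_sum_anti S W : S \subset W -> upper_sum mu W <= upper_sum mu S.
Proof.
move=> SW; rewrite /upper_sum [leRHS](bigID (fun Z => W \subset Z))/=.
rewrite (eq_bigl (fun Z : {set I} => (S \subset Z) && (W \subset Z))).
  by rewrite lerDl sumr_ge0.
move=> Z; apply/idP/andP => [WZ|[]//]; split => //.
exact: subset_trans WZ.
Qed.

Lemma le_upper_sum S : mu S <= upper_sum mu S.
Proof. by rewrite /upper_sum (bigD1 S)//= lerDl sumr_ge0. Qed.

(** By inclusion-exclusion the alternating sum is the probability that the random set meets [B]
    exactly in [V]. *)
Lemma le_signed_upper_sum B V : V \subset B ->
  mu V <= \sum_(W : {set I} | (V \subset W) && (W \subset B))
            (-1) ^+ (#|W| + #|V|) * upper_sum mu W.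
Proof.
move=> VB.
rewrite [leRHS](_ : _ = \sum_(Z | B :&: Z == V) mu Z).
  by rewrite (bigD1 V)/= ?lerDl ?sumr_ge0//; apply/eqP/setIidPr.
transitivity (\sum_Z mu Z * (-1) ^+ #|V| *
    \sum_(W : {set I} | (V \subset W) && (W \subset B :&: Z)) (-1) ^+ #|W|).
  under eq_bigr do rewrite /upper_sum big_distrr/=.
  under [RHS]eq_bigr do rewrite big_distrr/=.
  rewrite (exchange_big_dep xpredT)//=; apply: eq_bigr => Z _.
  apply: eq_big => [W|W _]; first by rewrite subsetI andbA.
  by rewrite exprD; ring.
rewrite [RHS]big_mkcond/=; apply: eq_bigr => Z _.
have [VZ|VZ] := boolP (V \subset Z).
  rewrite sum_sign_interval ?subsetI ?VB// eq_sym.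
  case: eqP => _; last by rewrite mul0r mulr0.
  by rewrite mul1r -mulrA -exprD addnn -mul2n exprM sqrrN !expr1n mulr1.
rewrite ifN; last first.
  by apply: contra VZ => /eqP <-; rewrite finset.subsetIr.
rewrite big_pred0 ?mulr0// => W; apply/negP => /andP[VW].
by rewrite subsetI => /andP[_ WZ]; rewrite (subset_trans VW WZ) in VZ.
Qed.

Lemma card_lt_pow (m : nat) : (m <= #|I|)%N -> m.+1%:R <= K.
Proof.
move=> mI; rewrite -natrX ler_nat.
exact: leq_trans (ltn_expl #|I| (ltnSn 1)).
Qed.

Lemma powK_ge1 : 1 <= K.
Proof. by rewrite -natrX ler1n expn_gt0. Qed.

Lemma sum_set_le (P : pred {set I}) (F : {set I} -> R) (M : R) : 0 <= M ->
  (forall W, P W -> `|F W| <= M) -> `|\sum_(W | P W) F W| <= K * M.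
Proof.
move=> M0 FM; apply: le_trans (ler_norm_sum _ _ _) _.
apply: le_trans (ler_sum _ FM) _.
rewrite sumr_const -[leLHS]mulr_natl; apply: ler_wpM2r => //.
rewrite -natrX ler_nat -[X in (_ <= 2 ^ X)%N]cardsT -card_powerset.
rewrite [leqRHS](_ : _ = #|{: {set I}}|); first exact: max_card.
by apply: eq_card => W; rewrite powersetE subsetT.
Qed.

(** By Bernoulli's inequality [p * (1 - p) ^+ m] is within [m%:R * p ^+ 2] of [p]; the other term is
    at most [p ^+ 2] in absolute value since [m] is at least 2. *)
Lemma bernoulli_moment_near m : (1 < m)%N -> (m <= #|I|)%N ->
  `|bernoulli_moment p m - p| <= K * p ^+ 2.
Proof.
move=> m1 mI.
have K1 := powK_ge1; have p0 := p_gt0.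
have p1 : p <= 1.
  apply: le_trans p_le _; apply: le_trans eps_le.
  have eps0 : 0 <= eps by apply: le_trans p_le; exact: ltW.
  rewrite ler_peMl// -[leLHS]mulr1 ler_pM//; first by lra.
  by rewrite exprn_ege1.
have bern k : 1 - k%:R * p <= (1 - p) ^+ k.
  elim: k => [|k IH]; first by rewrite mul0r subr0 expr0.
  rewrite exprS; apply: le_trans (ler_wpM2l _ IH); last by rewrite subr_ge0.
  rewrite -natr1 -subr_ge0.
  rewrite (_ : _ - _ = k%:R * p ^+ 2); last by ring.
  by rewrite mulr_ge0// sqr_ge0.
have -> : bernoulli_moment p m - p =
    - (p * (1 - (1 - p) ^+ m)) + (1 - p) * (- p) ^+ m.
  by rewrite /bernoulli_moment; ring.
apply: le_trans (ler_normD _ _) _.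
have pm : (1 - p) * p ^+ m <= p ^+ 2.
  apply: (@le_trans _ _ (1 * p ^+ m)).
    by apply: ler_wpM2r; [exact: exprn_ge0 (ltW p_gt0)|lra].
  by rewrite mul1r; apply: ler_wiXn2l => //; exact: ltW.
apply: (@le_trans _ _ (m%:R * p ^+ 2 + p ^+ 2)); last first.
  rewrite -[X in _ + X]mul1r -mulrDl natr1 ler_wpM2r ?sqr_ge0//.
  exact: card_lt_pow.
apply: lerD.
  rewrite normrN ger0_norm; last first.
    rewrite mulr_ge0 ?(ltW p_gt0)// subr_ge0 exprn_ile1//; lra.
  rewrite expr2 mulrCA ler_pM2l//.
  by have := bern m; lra.
by rewrite normrM normrX normrN ger0_norm ?(ger0_norm (ltW p_gt0))//; lra.
Qed.

Lemma bernoulli_moment_ge m : (1 < m)%N -> (m <= #|I|)%N ->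
  p / 2 <= bernoulli_moment p m.
Proof.
move=> m1 mI; have := bernoulli_moment_near m1 mI; rewrite ler_norml.
have : K * p ^+ 2 <= p / 2; last by lra.
rewrite expr2 mulrA mulrC ler_pM2l//.
have K1 := powK_ge1; have p0 := p_gt0.
have : K * p <= K ^+ 3 * eps.
  apply: ler_pM => //; [lra|exact: ltW|].
  by rewrite exprS ler_peMr ?exprn_ege1//; lra.
by move: eps_le; lra.
Qed.

Section FixedBlock.
Variables B V : {set I}.
Hypotheses (VB : V \subset B) (cardV : (1 < #|V|)%N).
(** The left sides are the absolute values of the terms of [central_momentE] for nonempty proper
    subsets of [W]. For Gaussian thresholds the bound will follow from the energy inequality for [S]
    and [W]. *)
Hypothesis dominated : forall W S, V \subset W -> W \subset B ->
  S != finset.set0 -> S \proper W ->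
  p ^+ #|W :\: S| * upper_sum mu S <= eps * mu V.

Lemma dominated_upper_sum W : V \subset W -> W \subset B ->
  p * upper_sum mu W <= eps * mu V.
Proof.
move=> VW WB; have cardW := leq_trans cardV (subset_leq_card VW).
have /card_gt0P[i iW] : (0 < #|W|)%N by exact: ltnW.
have := dominated (S := W :\ i) VW WB.
rewrite -card_gt0; move: (cardsD1 i W) cardW; rewrite iW => -> cardW.
rewrite (properD1 iW) (_ : W :\: (W :\ i) = [set i]); last first.
  by apply/setP => j; rewrite !inE; case: eqP => [->|]; rewrite ?iW//= andNb.
rewrite cards1 expr1 => h; apply: le_trans (h _ isT); last by lia.
by rewrite ler_pM2l// upper_sum_anti// subD1set.
Qed.

(** In [central_momentE] the term [S = W] is the upper sum; each of the others is small by
    [dominated]. *)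
Lemma central_moment_near W : V \subset W -> W \subset B ->
  `|central_moment p mu W - upper_sum mu W| <= K * (eps * mu V).
Proof.
move=> VW WB; have cardW := leq_trans cardV (subset_leq_card VW).
have eps0 : 0 <= eps by apply: le_trans p_le; exact: ltW.
rewrite central_momentE (bigD1 W)//= setDv cards0 expr0 mul1r.
rewrite addrAC subrr add0r; apply: sum_set_le => [|S /andP[SW nSW]].
  by rewrite mulr_ge0.
rewrite normrM normrX normrN (ger0_norm (ltW p_gt0)) (ger0_norm (upper_sum_ge0 _)).
have [->|S0] := eqVneq S finset.set0; last first.
  by apply: dominated => //; rewrite finset.properEneq nSW.
(* The empty set is reduced to a singleton, whose upper sum [p] supplies the missing factor. *)
have /card_gt0P[i iW] : (0 < #|W|)%N by exact: ltnW.
apply: le_trans (dominated (S := [set i]) VW WB _ _); last 2 first.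
- by apply/set0Pn; exists i; rewrite inE.
- by rewrite finset.properEcard finset.sub1set iW cards1.
rewrite mu_total mu_marginal mulr1 finset.setD0 (cardsD1 i W) iW exprS mulrC.
by [].
Qed.

(** Replacing central moments by upper sums and Bernoulli moments by [p] turns [p] times the weight
    into the sum of [le_signed_upper_sum], which is at least [mu V]. The errors add up to at most
    [4 * K ^+ 2 * eps * mu V]. *)
Lemma inverted_moment_ge0 : 0 <= inverted_moment p mu B V.
Proof.
have K1 := powK_ge1; have p0 := p_gt0.
have eps0 : 0 <= eps by apply: le_trans p_le; exact: ltW.
rewrite -(pmulr_rge0 _ p_gt0).
(* [f W] is the error made by these two replacements in the term of [W]. *)
pose f W := p * (central_moment p mu W / bernoulli_moment p #|W|) - upper_sum mu W.
have fK W : (V \subset W) && (W \subset B) ->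
    `|(-1) ^+ (#|W| + #|V|) * f W| <= 4 * K * (eps * mu V).
  move=> /andP[VW WB]; have cardW := leq_trans cardV (subset_leq_card VW).
  rewrite normrM normrX normrN1 expr1n mul1r.
  have bge := bernoulli_moment_ge cardW (max_card _).
  have bnear := bernoulli_moment_near cardW (max_card _).
  have near := central_moment_near VW WB.
  have dom := dominated_upper_sum VW WB.
  have u0 := upper_sum_ge0 W.
  have b0 : 0 < bernoulli_moment p #|W| by move: p_gt0 bge; lra.
  rewrite /f; move: (bernoulli_moment _ _) bge bnear b0 => b bge bnear b0.
  have -> : p * (central_moment p mu W / b) - upper_sum mu W =
      (p * (central_moment p mu W - upper_sum mu W) -
       upper_sum mu W * (b - p)) / b.
    by field; rewrite gt_eqF.
  rewrite normrM (gtr0_norm (x := b^-1)) ?invr_gt0// ler_pdivrMr//.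
  apply: (@le_trans _ _ (4 * K * (eps * mu V) * (p / 2))); last first.
    by rewrite ler_wpM2l// mulr_ge0// ?mulr_ge0//; lra.
  apply: le_trans (ler_normB _ _) _; rewrite !normrM.
  rewrite (gtr0_norm p_gt0) (ger0_norm u0).
  apply: (@le_trans _ _ (p * (K * (eps * mu V)) + upper_sum mu W * (K * p ^+ 2))).
    by apply: lerD; rewrite ler_wpM2l// ltW.
  have -> : upper_sum mu W * (K * p ^+ 2) = (K * p) * (p * upper_sum mu W).
    by ring.
  have : K * p * (p * upper_sum mu W) <= K * p * (eps * mu V).
    by rewrite ler_wpM2l// mulr_ge0 ?(ltW p_gt0)//; lra.
  by lra.
have := sum_set_le _ fK.
have e0 : 0 <= eps * mu V by rewrite mulr_ge0.
have -> : p * inverted_moment p mu B V =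
   \sum_(W : {set I} | (V \subset W) && (W \subset B))
            (-1) ^+ (#|W| + #|V|) * upper_sum mu W +
   \sum_(W : {set I} | (V \subset W) && (W \subset B))
            (-1) ^+ (#|W| + #|V|) * f W.
  rewrite /inverted_moment big_distrr/= -big_split/=; apply: eq_bigr => W _.
  by rewrite /f; ring.
have := le_signed_upper_sum VB.
move: (\sum_(_ | _) _ * upper_sum _ _) (\sum_(_ | _) _ * f _) => x y mux.
move=> /(_ (mulr_ge0 _ e0)); rewrite ler_norml mulr_ge0//; last by lra.
move=> /(_ isT)/andP[yge _].
have : K * (4 * K * (eps * mu V)) <= mu V; last by lra.
rewrite !mulrA -[leRHS]mul1r ler_wpM2r//; apply: le_trans eps_le.
rewrite ler_wpM2r// (_ : K * 4 * K = 4 * K ^+ 2); last by ring.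
by rewrite ler_pM2l// (exprS _ 2) ler_peMl// exprn_ge0//; lra.
Qed.

(** Keeps the total weight of the large sets below 1, so that the mass left for the empty set is
    nonnegative. Each central moment is at most [3 / 2 * eps * p], and each Bernoulli moment at
    least [p / 2]. *)
Lemma inverted_moment_le : upper_sum mu V <= eps * p ->
  inverted_moment p mu B V <= K * (3 * eps).
Proof.
move=> Vsmall.
have K1 := powK_ge1; have p0 := p_gt0.
have eps0 : 0 <= eps by apply: le_trans p_le; exact: ltW.
apply: le_trans (ler_norm _) _; apply: sum_set_le => [|W /andP[VW WB]].
  by rewrite mulr_ge0.
have cardW := leq_trans cardV (subset_leq_card VW).
rewrite normrM normrX normrN1 expr1n mul1r.
have bge := bernoulli_moment_ge cardW (max_card _).
have b0 : 0 < bernoulli_moment p #|W| by move: p_gt0 bge; lra.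
rewrite normrM (gtr0_norm (x := _^-1)) ?invr_gt0// ler_pdivrMr//.
apply: (@le_trans _ _ (3 * eps * (p / 2))); last first.
  by rewrite ler_wpM2l// mulr_ge0.
have near := central_moment_near VW WB.
have uW : upper_sum mu W <= eps * p := le_trans (upper_sum_anti VW) Vsmall.
have muV : mu V <= eps * p := le_trans (le_upper_sum _) Vsmall.
have : K * (eps * mu V) <= K * eps * (eps * p).
  by rewrite mulrA ler_wpM2l// mulr_ge0//; lra.
have : K * eps * (eps * p) <= 1 / 2 * (eps * p).
  rewrite ler_wpM2r ?mulr_ge0// ?(ltW p_gt0)//.
  have : K * eps <= K ^+ 3 * eps.
    rewrite ler_wpM2r// (exprS _ 2) ler_peMr ?exprn_ege1//; lra.
  by move: eps_le; lra.
have := upper_sum_ge0 W.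
move: near; rewrite !ler_norml => /andP[n1 n2] u0 h1 h2; apply/andP; split; lra.
Qed.

End FixedBlock.

Lemma block_weight_ge0 B V :
  (forall V W S, V \subset W -> W \subset B -> (1 < #|V|)%N ->
     S != finset.set0 -> S \proper W ->
     p ^+ #|W :\: S| * upper_sum mu S <= eps * mu V) ->
  (forall V, V \subset B -> (1 < #|V|)%N -> upper_sum mu V <= eps * p) ->
  V \subset B -> 0 <= block_weight p mu B V.
Proof.
move=> dominated small VB; rewrite /block_weight.
case: ifPn => [V1|_].
  by apply: inverted_moment_ge0 => // W S VW WB; apply: dominated.
case: ifP => // _; rewrite subr_ge0.
have K1 := powK_ge1; have p0 := p_gt0.
have eps0 : 0 <= eps by apply: le_trans p_le; exact: ltW.
apply: le_trans (ler_norm _) _.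
apply: (@le_trans _ _ (K * (K * (3 * eps)))).
  apply: sum_set_le => [|U /andP[UB U1]]; first by rewrite !mulr_ge0//; lra.
  have dom W S : U \subset W -> W \subset B -> S != finset.set0 ->
      S \proper W -> p ^+ #|W :\: S| * upper_sum mu S <= eps * mu U.
    by move=> UW WB; apply: dominated.
  rewrite ger0_norm ?inverted_moment_le ?inverted_moment_ge0//.
  exact: small.
apply: le_trans eps_le.
rewrite !mulrA -expr2 ler_wpM2r// mulrC.
have : K ^+ 2 <= K ^+ 3 by rewrite (exprS _ 2) ler_peMl// exprn_ge0//; lra.
have : 0 <= K ^+ 2 by rewrite exprn_ge0//; lra.
by lra.
Qed.

End Positivity.

(** * Equilibrium measures of inverse Stieltjes matrices *)

Section Equilibrium.
Variables (R : realFieldType) (n : nat).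
Implicit Types (A G : 'M[R]_n) (u v x : 'rV[R]_n) (S T W B : {set 'I_n}).

Definition posdef_form A :=
  forall v, v != 0 -> 0 < (v *m A *m v^T) 0 0.

Lemma row_formE A u v : (u *m A *m v^T) 0 0 = \sum_j (u *m A) 0 j * v 0 j.
Proof. by rewrite mxE; apply: eq_bigr => j _; rewrite [v^T _ _]mxE. Qed.

Lemma row_form_sumE A u v :
  (u *m A *m v^T) 0 0 = \sum_j \sum_i u 0 i * A i j * v 0 j.
Proof.
by rewrite row_formE; apply: eq_bigr => j _; rewrite mxE big_distrl.
Qed.

Lemma row_form_sym A u v : A^T = A ->
  (u *m A *m v^T) 0 0 = (v *m A *m u^T) 0 0.
Proof.
move=> symA.
have -> : u *m A *m v^T = (v *m A *m u^T)^T by rewrite !trmx_mul trmxK symA mulmxA.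
by rewrite mxE.
Qed.

Lemma row_formD A u v : A^T = A ->
  ((u + v) *m A *m (u + v)^T) 0 0 =
  (u *m A *m u^T) 0 0 + (u *m A *m v^T) 0 0 *+ 2 + (v *m A *m v^T) 0 0.
Proof.
move=> symA; have add00 (M N : 'M[R]_1) : (M + N) 0 0 = M 0 0 + N 0 0.
  by rewrite !mxE.
rewrite !mulmxDl linearD/= !mulmxDr !add00 (row_form_sym v u symA); ring.
Qed.

Lemma row_formZl A k u v :
  ((k *: u) *m A *m v^T) 0 0 = k * (u *m A *m v^T) 0 0.
Proof. by rewrite -!scalemxAl [LHS]mxE. Qed.

Lemma row_formZ A k u :
  ((k *: u) *m A *m (k *: u)^T) 0 0 = k ^+ 2 * (u *m A *m u^T) 0 0.
Proof.
rewrite row_formZl linearZ/= -scalemxAr [X in _ * X]mxE expr2.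
by rewrite mulrA.
Qed.

Lemma posdef_unitmx A : posdef_form A -> A \in unitmx.
Proof.
move=> posA; rewrite unitmxE unitfE; apply/negP => /det0P[v v0 vA].
by have := posA v v0; rewrite vA mul0mx mxE ltxx.
Qed.

Lemma posdef_invmx A : A^T = A -> posdef_form A -> posdef_form (invmx A).
Proof.
move=> symA posA v v0; have uA := posdef_unitmx posA.
have := posA (v *m invmx A).
rewrite trmx_mul trmx_inv symA !mulmxA mulmxKV//; apply.
by apply: contra v0 => /eqP vA0; rewrite -(mulmxKV uA v) vA0 mul0mx.
Qed.

Lemma row_form_delta A k l :
  ((delta_mx 0 k : 'rV_n) *m A *m (delta_mx 0 l : 'rV_n)^T) 0 0 = A k l.
Proof.
rewrite row_formE -rowE (bigD1 l)//= !mxE !eqxx mulr1.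
by rewrite big1 ?addr0// => m /negbTE ml; rewrite !mxE ml andbF mulr0.
Qed.

Lemma posdef_diag A i : posdef_form A -> 0 < A i i.
Proof.
move=> /(_ (delta_mx 0 i)); rewrite row_form_delta; apply.
apply/negP => /eqP/matrixP/(_ 0 i); rewrite !mxE !eqxx /= => /eqP.
by rewrite oner_eq0.
Qed.

Lemma posdef_offdiag A i j : A^T = A -> posdef_form A -> i != j ->
  A i j *+ 2 < A i i + A j j.
Proof.
move=> symA posA ij; have := posA (delta_mx 0 i - delta_mx 0 j).
have Aji : A j i = A i j by rewrite -[in LHS]symA mxE.
have sub00 (M N : 'M[R]_1) : (M - N) 0 0 = M 0 0 - N 0 0 by rewrite !mxE.
rewrite mulmxBl linearB/= mulmxBr !mulmxBl !sub00 !row_form_delta Aji.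
have -> : A i i - A i j - (A i j - A j j) = A i i + A j j - A i j *+ 2 by ring.
rewrite subr_gt0; apply.
apply/negP => /eqP/matrixP/(_ 0 i); rewrite !mxE !eqxx (negbTE ij) /= subr0.
by move/eqP; rewrite oner_eq0.
Qed.

(** A square linear system: the columns of [M] are those of the identity on [S] and those of [G]
    elsewhere. A vector in its left kernel vanishes on [S] and is harmonic off [S], so its quadratic
    form is 0. *)
Lemma harmonic_extension G S : G^T = G -> posdef_form G ->
  exists x, (forall i, i \in S -> x 0 i = 1) /\
            (forall i, i \notin S -> (x *m G) 0 i = 0).
Proof.
move=> symG posG.
pose M : 'M[R]_n := \matrix_(i, j) if j \in S then (i == j)%:R else G i j.
have xM x i : (x *m M) 0 i = if i \in S then x 0 i else (x *m G) 0 i.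
  rewrite mxE; case: ifPn => iS.
    rewrite (bigD1 i)//= mxE iS eqxx mulr1 big1 ?addr0// => j /negbTE ji.
    by rewrite mxE iS ji mulr0.
  by rewrite [RHS]mxE; apply: eq_bigr => j _; rewrite mxE (negbTE iS).
have uM : M \in unitmx.
  rewrite unitmxE unitfE; apply/negP => /det0P[x x0 xM0].
  have := posG x x0; rewrite row_formE big1 ?ltxx// => i _.
  have := xM x i; rewrite xM0 mxE; case: ifP => _ <-; by rewrite ?mul0r ?mulr0.
pose b : 'rV[R]_n := \row_i (i \in S)%:R.
exists (b *m invmx M); split => i iS.
  by have := xM (b *m invmx M) i; rewrite mulmxKV// iS mxE iS.
by have := xM (b *m invmx M) i; rewrite mulmxKV// (negbTE iS) mxE (negbTE iS).
Qed.

(** Test against [w], the positive part of [x - 1]. It vanishes on [S], and off [S] the vector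
    [(x - 1) *m G] is nonpositive; the negative part [z] has disjoint support, so it meets [w] only
    through off-diagonal entries. Hence the form of [w] is at most 0 and [w = 0]. *)
Lemma maximum_principle G S x : posdef_form G ->
  (forall i j, i != j -> G i j <= 0) ->
  (forall i, 0 <= ((const_mx 1 : 'rV_n) *m G) 0 i) ->
  (forall i, i \in S -> x 0 i = 1) ->
  (forall i, i \notin S -> (x *m G) 0 i = 0) ->
  forall i, x 0 i <= 1.
Proof.
move=> posG offG rowG x1 xG0.
pose w : 'rV[R]_n := \row_i Num.max 0 (x 0 i - 1).
pose z : 'rV[R]_n := \row_i Num.max 0 (1 - x 0 i).
have xwz : x - const_mx 1 = w - z.
  apply/rowP => i; rewrite !mxE /Num.max.
  by case: ltP => h1; case: ltP => h2; lra.
suff w0 : w = 0.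
  move=> i; have /rowP/(_ i) := w0; rewrite !mxE /Num.max.
  by case: ltP => h; lra.
apply/eqP; apply: contraT => /posG; rewrite ltNge => /negP; elim.
have -> : w *m G *m w^T = (x - const_mx 1) *m G *m w^T + z *m G *m w^T.
  by rewrite -!mulmxDl xwz subrK.
have add00 (M N : 'M[R]_1) : (M + N) 0 0 = M 0 0 + N 0 0 by rewrite !mxE.
rewrite add00 -[leRHS]addr0; apply: lerD.
  rewrite row_formE; apply: sumr_le0 => i _; rewrite mulmxBl.
  have sub0i (M N : 'rV[R]_n) : (M - N) 0 i = M 0 i - N 0 i by rewrite !mxE.
  rewrite sub0i.
  have [iS|iS] := boolP (i \in S).
    by rewrite [w 0 i]mxE x1// subrr maxxx mulr0.
  rewrite xG0// add0r mulNr oppr_le0 mulr_ge0//.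
  by rewrite [w 0 i]mxE le_max lexx.
rewrite row_form_sumE; apply: sumr_le0 => i _; apply: sumr_le0 => j _.
rewrite !mxE.
have [->|ji] := eqVneq j i.
  rewrite /Num.max; case: ltP => h1; case: ltP => h2; rewrite ?mulr0 ?mul0r//.
  by lra.
rewrite mulrAC mulr_ge0_le0// ?offG//.
by rewrite mulr_ge0// le_max lexx.
Qed.

(* [l] is the equilibrium measure of [S] for the Green kernel [A], and its
   energy [\sum_i l 0 i] is the minimum of [x A^-1 x^T] under [x = 1] on [S]. *)
Definition equilibrium A S (l : 'rV[R]_n) :=
  [/\ (forall i, 0 <= l 0 i),
      (forall i, i \notin S -> l 0 i = 0),
      (forall i, i \in S -> (l *m A) 0 i = 1) &
      (forall i, (l *m A) 0 i <= 1)].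

(** Take [l = x *m invmx A] for the harmonic extension [x]. On [S] it dominates the row sum
    [1^T A^-1], since [x] is 1 at the given index and at most 1 where the coefficients are
    nonpositive. *)
Lemma equilibrium_exists A S : A^T = A -> posdef_form A ->
  (forall i j, i != j -> invmx A i j <= 0) ->
  (forall i, 0 <= ((const_mx 1 : 'rV_n) *m invmx A) 0 i) ->
  exists l, equilibrium A S l.
Proof.
move=> symA posA offG rowG; have posG := posdef_invmx symA posA.
have uA := posdef_unitmx posA.
have symG : (invmx A)^T = invmx A by rewrite trmx_inv symA.
have [x [x1 xG0]] := harmonic_extension S symG posG.
have xle := maximum_principle posG offG rowG x1 xG0.
exists (x *m invmx A); rewrite /equilibrium mulmxKV//; split => // i.
have [iS|iS] := boolP (i \in S); last by rewrite xG0.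
apply: le_trans (rowG i) _; rewrite !mxE; apply: ler_sum => j _.
rewrite mxE; have [->|ji] := eqVneq j i; first by rewrite x1.
by rewrite ler_wnM2r// offG.
Qed.

Definition energy (l : 'rV[R]_n) := \sum_i l 0 i.

(** Evaluate the symmetric pairing of [l] and [m] under [A] in two ways: [l *m A] is 1 on the
    support of [m], while [m *m A] is known to be 1 only on [T]. *)
Lemma energy_diff A S T l m : A^T = A -> equilibrium A S l ->
  equilibrium A T m -> T \subset S ->
  energy l = energy m + \sum_(j in S :\: T) l 0 j * (1 - (m *m A) 0 j).
Proof.
move=> symA [l0 lS lA lA1] [m0 mT mA mA1] TS.
have : (l *m A *m m^T) 0 0 = (m *m A *m l^T) 0 0 by exact: row_form_sym.
rewrite !row_formE.
rewrite (_ : \sum_j (l *m A) 0 j * m 0 j = energy m); last first.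
  apply: eq_bigr => j _; have [jT|jT] := boolP (j \in T).
    by rewrite lA ?mul1r// (subsetP TS).
  by rewrite mT// mulr0.
move=> ->; rewrite /energy [X in _ = _ + X]big_mkcond/= -big_split/=.
apply: eq_bigr => j _; rewrite inE.
have [jT|jT] := boolP (j \in T); first by rewrite mA//= mul1r addr0.
have [jS|jS] := boolP (j \in S) => /=; first by ring.
by rewrite lS// mulr0 addr0.
Qed.

Lemma energy_mono A S T l m : A^T = A -> equilibrium A S l ->
  equilibrium A T m -> T \subset S -> energy m <= energy l.
Proof.
move=> symA eqS eqT TS; rewrite (energy_diff symA eqS eqT TS) lerDl.
case: eqS eqT => [l0 _ _ _] [_ _ _ m1]; apply: sumr_ge0 => j _.
by rewrite mulr_ge0// subr_ge0.
Qed.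

(** Each term of [energy_diff] is below [1 / a]: the diagonal alone forces [l 0 j <= 1 / a], and
    [(m *m A) 0 j] is positive because [m] charges some point of [T] and the entries inside a block
    are positive. *)
Lemma energy_subadditive A S T B l m a : A^T = A -> 0 < a ->
  (forall i, A i i = a) -> (forall i j, 0 <= A i j) ->
  (forall i j, i \in B -> j \in B -> 0 < A i j) ->
  equilibrium A S l -> equilibrium A T m -> T \proper S -> S \subset B ->
  T != finset.set0 ->
  energy l < energy m + #|S :\: T|%:R / a.
Proof.
move=> symA a0 diagA A0 Apos eqS eqT TS SB T0.
rewrite (energy_diff symA eqS eqT (proper_sub TS)) ltrD2l.
have [l0 _ _ l1] := eqS; have [m0 mT mA m1] := eqT.
have lle j : l 0 j <= 1 / a.
  rewrite ler_pdivlMr// -(diagA j); apply: le_trans (l1 j).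
  by rewrite mxE (bigD1 j)//= lerDl sumr_ge0// => i _; rewrite mulr_ge0.
have mpos j : j \in S -> 0 < (m *m A) 0 j.
  move=> jS; have TB := subset_trans (proper_sub TS) SB.
  have [t tT] := set0Pn _ T0.
  have [i iT mi] : exists2 i, i \in T & m 0 i != 0.
    apply/exists_inP; apply: contraT => /exists_inPn h.
    have := mA t tT; rewrite mxE big1 => [/eqP|i _].
      by rewrite eq_sym oner_eq0.
    have [iT|iT] := boolP (i \in T); last by rewrite mT// mul0r.
    by have := h i iT; rewrite negbK => /eqP ->; rewrite mul0r.
  rewrite mxE (bigD1 i)//= ltr_pwDl ?sumr_ge0//.
    have iB := subsetP TB i iT; have jB := subsetP SB j jS.
    by rewrite mulr_gt0 ?Apos// lt_def mi m0.
  by move=> k _; rewrite mulr_ge0.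
have lt_term j : j \in S -> l 0 j * (1 - (m *m A) 0 j) < a^-1.
  move=> jS; rewrite -div1r; apply: (@le_lt_trans _ _ (1 / a * (1 - (m *m A) 0 j))).
    by rewrite ler_wpM2r ?lle// subr_ge0 m1.
  by rewrite gtr_pMr ?divr_gt0// ltrBlDr ltrDl mpos.
have /properP[_ [j jS jT]] := TS.
rewrite mulr_natl -sumr_const -subr_gt0 -sumrB (bigD1 j)/= ?inE ?jS ?jT//.
rewrite ltr_pwDl ?subr_gt0 ?lt_term//.
apply: sumr_ge0 => k; rewrite inE => /andP[/andP[_ kS] _].
by rewrite subr_ge0 ltW ?lt_term.
Qed.

Lemma energy_set1 A i m a : 0 < a -> A i i = a ->
  equilibrium A [set i] m -> energy m = 1 / a.
Proof.
move=> a0 Aii [_ mi mA _].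
have mji j : j != i -> m 0 j = 0 by move=> ji; rewrite mi// inE.
have := mA i; rewrite inE eqxx => /(_ isT); rewrite mxE (bigD1 i)//= Aii big1.
  rewrite addr0 /energy (bigD1 i)//= big1 ?addr0 => [ma|j /mji//].
  by rewrite -ma mulfK// gt_eqF.
by move=> j /mji ->; rewrite mul0r.
Qed.

(** Compare with a singleton [[set i]]. Equality would concentrate [l] on [i], since the potential
    of [m] is below 1 elsewhere; then [l *m A] equal to 1 at both [i] and [j] gives [A i j = a],
    against positive definiteness. *)
Lemma energy_gt A S l a : A^T = A -> posdef_form A -> 0 < a ->
  (forall i, A i i = a) ->
  (forall T, exists m, equilibrium A T m) ->
  equilibrium A S l -> (1 < #|S|)%N -> 1 / a < energy l.
Proof.
move=> symA posA a0 diagA ex eqS /card_gt1P[i [j [iS jS ij]]].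
have [m eqi] := ex [set i].
have iS1 : [set i] \subset S by rewrite finset.sub1set.
rewrite lt_neqAle -(energy_set1 a0 (diagA i) eqi) (energy_mono symA eqS eqi iS1).
rewrite andbT; apply/negP => /eqP e.
have := energy_diff symA eqS eqi iS1; rewrite -e -[X in X = _]addr0.
move=> /addrI/esym/eqP.
have [l0 lS lA l1] := eqS; have [m0 mi mA m1] := eqi.
have mk k : m 0 k = (k == i)%:R / a.
  have [->|ki] := eqVneq k i.
    rewrite mul1r -div1r -(energy_set1 a0 (diagA i) eqi) /energy (bigD1 i)//= big1 ?addr0//.
    by move=> k' ki'; rewrite mi// inE.
  by rewrite mi ?mul0r// inE.
have mAk k : (m *m A) 0 k = A i k / a.
  rewrite mxE (bigD1 i)//= mk eqxx mul1r big1 ?addr0 1?mulrC// => k' ki'.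
  by rewrite mk (negbTE ki') !mul0r.
have lt1 k : k != i -> (m *m A) 0 k < 1.
  move=> ki; have Aik : A i k = A k i by rewrite -[in LHS]symA mxE.
  rewrite mAk ltr_pdivrMr// mul1r Aik.
  by have := posdef_offdiag symA posA ki; rewrite !diagA -mulr2n ltrMn2r.
rewrite psumr_eq0 => [/allP h|k _]; last by rewrite mulr_ge0// subr_ge0.
have lk k : k != i -> l 0 k = 0.
  move=> ki; have [kS|kS] := boolP (k \in S); last exact: lS.
  have := h k (mem_index_enum _); rewrite !inE ki kS /= mulf_eq0.
  by rewrite (gt_eqF (x := 1 - _)) ?subr_gt0 ?lt1// orbF => /eqP.
have lAk k : (l *m A) 0 k = l 0 i * A i k.
  by rewrite mxE (bigD1 i)//= big1 ?addr0// => k' /lk ->; rewrite mul0r.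
have := lA j jS; have := lA i iS; rewrite !lAk diagA => <- /(mulfI _) E.
have : A i j = a.
  apply: E; apply/eqP => li0; have := lA i iS.
  by rewrite lAk li0 mul0r => /eqP; rewrite eq_sym oner_eq0.
move=> Aij; have := lt1 j; rewrite eq_sym => /(_ ij).
by rewrite mAk Aij divff ?ltxx// gt_eqF.
Qed.

End Equilibrium.

From mathcomp Require Import all_classical all_reals all_analysis.
From mathcomp Require Import measurable_realfun normal_distribution.
Import numFieldNormedType.Exports.
Local Open Scope classical_set_scope.
Local Open Scope ring_scope.

(** * Iterated Lebesgue integrals *)

Section TupleIntegral.
Variable R : realType.
Local Notation mu := (@lebesgue_measure R).
Local Open Scope ereal_scope.

Lemma tuple_integral_ge0 n (F : n.-tuple R -> \bar R) :
  (forall x, 0 <= F x) -> 0 <= tuple_integral F.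
Proof.
elim: n F => [|n IH] F F0 /=; first exact: F0.
by apply: integral_ge0 => x _; apply: IH.
Qed.

Lemma eq_tuple_integral n (F G : n.-tuple R -> \bar R) :
  F =1 G -> tuple_integral F = tuple_integral G.
Proof. by move=> /funext ->. Qed.

Lemma measurable_cons_tuple n :
  measurable_fun setT (fun z : R * n.-tuple R => cons_tuple z.1 z.2).
Proof. exact: measurable_cons. Qed.

(** The parameter space is arbitrary so that the induction can absorb each integration variable into
    the parameter. *)
Lemma measurable_tuple_integral d (T : measurableType d) n
    (F : T -> n.-tuple R -> \bar R) :
  measurable_fun setT (fun z : T * n.-tuple R => F z.1 z.2) ->
  (forall t x, 0 <= F t x) ->
  measurable_fun setT (fun t => tuple_integral (F t)).
Proof.
elim: n d T F => [|n IH] d T F mF F0 /=.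
  exact: (measurableT_comp mF (measurable_pair2 [tuple])).
apply: (measurable_fun_fubini_tonelli_F (m2 := mu)
  (fun z : T * R => tuple_integral (fun t => F z.1 (cons_tuple z.2 t)))).
  apply: (IH _ _ (fun z : T * R => fun t => F z.1 (cons_tuple z.2 t))) => //.
  apply: (measurableT_comp mF
    (g := fun z : T * R * n.-tuple R => (z.1.1, cons_tuple z.1.2 z.2))).
  apply: measurable_fun_pair.
    exact: (measurableT_comp measurable_fst measurable_fst).
  apply: measurable_cons; last exact: measurable_snd.
  exact: (measurableT_comp measurable_snd measurable_fst).
by move=> z; apply: tuple_integral_ge0 => x; exact: F0.
Qed.

Lemma measurable_cons_slice n (F : n.+1.-tuple R -> \bar R) :
  measurable_fun setT F ->
  measurable_fun setT (fun z : R * n.-tuple R => F (cons_tuple z.1 z.2)).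
Proof. by move=> mF; apply: (measurableT_comp mF); exact: measurable_cons_tuple. Qed.

Lemma measurable_slice n (F : n.+1.-tuple R -> \bar R) (x : R) :
  measurable_fun setT F -> measurable_fun setT (fun t => F (cons_tuple x t)).
Proof.
move=> /measurable_cons_slice mF.
exact: (measurableT_comp mF (pair1_measurable x)).
Qed.

Lemma measurable_integral_slice n (F : n.+1.-tuple R -> \bar R) :
  measurable_fun setT F -> (forall x, 0 <= F x) ->
  measurable_fun setT (fun x : R => tuple_integral (fun t => F (cons_tuple x t))).
Proof.
move=> mF F0.
apply: (@measurable_tuple_integral _ _ _ (fun x t => F (cons_tuple x t))) => //.
exact: measurable_cons_slice.
Qed.

Lemma tuple_integral_le n (F G : n.-tuple R -> \bar R) :
  measurable_fun setT F -> measurable_fun setT G ->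
  (forall x, 0 <= F x) -> (forall x, F x <= G x) ->
  tuple_integral F <= tuple_integral G.
Proof.
elim: n F G => [|n IH] F G mF mG F0 FG /=; first exact: FG.
have G0 x : 0 <= G x by apply: le_trans (FG x).
apply: ge0_le_integral => //.
- by move=> x _; apply: tuple_integral_ge0.
- exact: measurable_integral_slice.
- exact: measurable_integral_slice.
by move=> x _; apply: IH => //; exact: measurable_slice.
Qed.

Lemma tuple_integralZl n (k : \bar R) (F : n.-tuple R -> \bar R) :
  measurable_fun setT F -> (forall x, 0 <= F x) -> 0 <= k ->
  tuple_integral (fun x => k * F x) = k * tuple_integral F.
Proof.
elim: n F => [//|n IH] F mF F0 k0 /=.
under eq_integral => x _.
  rewrite (IH (fun t => F (cons_tuple x t)) (measurable_slice _ mF) (fun=> F0 _) k0).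
  over.
rewrite ge0_integralZl//; first exact: measurable_integral_slice.
by move=> x _; apply: tuple_integral_ge0.
Qed.

(** The image of Lebesgue measure under a translation agrees with it on half-open intervals, hence
    everywhere. *)
Lemma integral_shift (f : R -> \bar R) (s : R) :
  measurable_fun setT f -> (forall x, 0 <= f x) ->
  \int[mu]_x f (x + s)%R = \int[mu]_x f x.
Proof.
move=> mf f0.
pose phi : measurableTypeR R -> measurableTypeR R := fun x => (x + s)%R.
have mphi : measurable_fun setT phi by apply: measurable_funD.
transitivity (\int[pushforward mu phi]_x f x).
  by rewrite ge0_integral_pushforward.
apply: eq_measure_integral => A mA _; apply/esym.
apply: (@lebesgue_measure_unique _ (pushforward mu phi)) => // _ [[a b]] _ <-.
transitivity (mu `](a - s)%R, (b - s)%R]%classic); last first.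
  congr (mu _); apply/seteqP; split=> x; rewrite /= /phi !in_itv/=;
  by rewrite ltrBlDr lerBrDr.
by rewrite !lebesgue_measure_itv/= !lte_fin ltrD2r -!EFinB opprD addrACA subrr addr0.
Qed.

Definition shift_tuple n (s : 'I_n -> R) (x : n.-tuple R) : n.-tuple R :=
  [tuple (tnth x i + s i)%R | i < n].

Lemma shift_cons_tuple n (s : 'I_n.+1 -> R) (x : R) (t : n.-tuple R) :
  shift_tuple s (cons_tuple x t) =
  cons_tuple (x + s ord0)%R (shift_tuple (fun i => s (lift ord0 i)) t).
Proof.
apply: eq_from_tnth => i; rewrite tnth_mktuple.
by have [j ->|->] := unliftP ord0 i; rewrite ?tnthS ?tnth0 ?tnth_mktuple.
Qed.

Lemma measurable_shift_tuple n (s : 'I_n -> R) :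
  measurable_fun setT (shift_tuple s).
Proof.
apply/measurable_fun_tnthP => i.
rewrite (_ : _ \o _ = fun x : n.-tuple R => (tnth x i + s i)%R).
  by apply: measurable_funD => //; exact: measurable_tnth.
by apply/funext => x; rewrite /= tnth_mktuple.
Qed.

Lemma tuple_integral_shift n (s : 'I_n -> R) (F : n.-tuple R -> \bar R) :
  measurable_fun setT F -> (forall x, 0 <= F x) ->
  tuple_integral (F \o shift_tuple s) = tuple_integral F.
Proof.
elim: n s F => [|n IH] s F mF F0 /=; first by congr F; rewrite [LHS]tuple0.
under eq_integral => x _.
  under eq_tuple_integral do rewrite shift_cons_tuple.
  rewrite (IH _ (fun t => F (cons_tuple (x + s ord0)%R t)))//; last exact: measurable_slice.
  over.
rewrite (integral_shift (f := fun x => tuple_integral (fun t => F (cons_tuple x t))))//.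
  exact: measurable_integral_slice.
by move=> x; apply: tuple_integral_ge0.
Qed.

Lemma tuple_integral_swap n (F : R -> n.-tuple R -> \bar R) :
  measurable_fun setT (fun z : R * n.-tuple R => F z.1 z.2) ->
  (forall s x, 0 <= F s x) ->
  \int[mu]_s tuple_integral (F s) = tuple_integral (fun x => \int[mu]_s F s x).
Proof.
elim: n F => [//|n IH] F mF F0 /=.
have mF' : measurable_fun setT
    (fun z : R * R * n.-tuple R => F z.1.1 (cons_tuple z.1.2 z.2)).
  apply: (measurableT_comp mF
    (g := fun z : R * R * n.-tuple R => (z.1.1, cons_tuple z.1.2 z.2))).
  apply: measurable_fun_pair.
    exact: (measurableT_comp measurable_fst measurable_fst).
  apply: measurable_cons; last exact: measurable_snd.
  exact: (measurableT_comp measurable_snd measurable_fst).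
rewrite (fubini_tonelli (m1 := mu) (m2 := mu)
  (fun z : R * R => tuple_integral (fun t => F z.1 (cons_tuple z.2 t)))); last 2 first.
- by apply: (@measurable_tuple_integral _ _ _
    (fun z : R * R => fun t => F z.1 (cons_tuple z.2 t))).
- by move=> z; apply: tuple_integral_ge0 => t; exact: F0.
apply: eq_integral => x _; rewrite (IH (fun s t => F s (cons_tuple x t)))//.
apply: (measurableT_comp mF'
  (g := fun z : R * n.-tuple R => ((z.1, x), z.2))).
apply: measurable_fun_pair; last exact: measurable_snd.
by apply: measurable_fun_pair; [exact: measurable_fst|exact: measurable_cst].
Qed.

End TupleIntegral.

(** * Integration over some of the coordinates *)

Section PartialIntegral.
Variable R : realType.
Local Notation mu := (@lebesgue_measure R).
Local Open Scope ereal_scope.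

(** Coordinates with [b i] false are frozen at the default value 0, which is harmless for functions
    that do not depend on them. *)
Fixpoint partial_integral n : ('I_n -> bool) -> (n.-tuple R -> \bar R) -> \bar R :=
  match n return (('I_n -> bool) -> (n.-tuple R -> \bar R) -> \bar R) with
  | 0 => fun _ F => F [tuple]
  | m.+1 => fun b F =>
      let G x := partial_integral (fun i => b (lift ord0 i))
                   (fun t : m.-tuple R => F (cons_tuple x t)) in
      if b ord0 then \int[mu]_x G x else G 0%R
  end.

Lemma partial_integral_ge0 n b (F : n.-tuple R -> \bar R) :
  (forall x, 0 <= F x) -> 0 <= partial_integral b F.
Proof.
elim: n b F => [|n IH] b F F0 /=; first exact: F0.
by case: ifP => _; [apply: integral_ge0 => x _|]; apply: IH.
Qed.

Lemma measurable_partial_integral d (T : measurableType d) n b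
    (F : T -> n.-tuple R -> \bar R) :
  measurable_fun setT (fun z : T * n.-tuple R => F z.1 z.2) ->
  (forall t x, 0 <= F t x) ->
  measurable_fun setT (fun t => partial_integral b (F t)).
Proof.
elim: n d T b F => [|n IH] d T b F mF F0 /=.
  exact: (measurableT_comp mF (measurable_pair2 [tuple])).
case: (b ord0).
  apply: (measurable_fun_fubini_tonelli_F (m2 := mu)
    (fun z : T * R => partial_integral (fun i => b (lift ord0 i))
       (fun t => F z.1 (cons_tuple z.2 t)))).
    apply: (IH _ _ _ (fun z : T * R => fun t => F z.1 (cons_tuple z.2 t))) => //.
    apply: (measurableT_comp mF
      (g := fun z : T * R * n.-tuple R => (z.1.1, cons_tuple z.1.2 z.2))).
    apply: measurable_fun_pair.
      exact: (measurableT_comp measurable_fst measurable_fst).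
    apply: measurable_cons; last exact: measurable_snd.
    exact: (measurableT_comp measurable_snd measurable_fst).
  by move=> z; apply: partial_integral_ge0 => x; exact: F0.
apply: (IH _ _ _ (fun z => fun t => F z (cons_tuple 0%R t))) => //.
apply: (measurableT_comp mF
  (g := fun z : T * n.-tuple R => (z.1, cons_tuple 0%R z.2))).
apply: measurable_fun_pair; first exact: measurable_fst.
by apply: measurable_cons; [exact: measurable_cst|exact: measurable_snd].
Qed.

Definition depends_only n (b : 'I_n -> bool) U (F : n.-tuple R -> U) :=
  forall x y : n.-tuple R, (forall i, b i -> tnth x i = tnth y i) -> F x = F y.

Lemma depends_only_cons n (b : 'I_n.+1 -> bool) U (F : n.+1.-tuple R -> U) a :
  depends_only b F ->
  depends_only (fun i => b (lift ord0 i)) (fun t => F (cons_tuple a t)).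
Proof.
move=> bF x y xy; apply: bF => i.
by have [j ->|->] := unliftP ord0 i; rewrite ?tnthS ?tnth0//; exact: xy.
Qed.

Lemma depends_only_head n (b : 'I_n.+1 -> bool) U (F : n.+1.-tuple R -> U) a a' t :
  depends_only b F -> b ord0 = false ->
  F (cons_tuple a t) = F (cons_tuple a' t).
Proof.
move=> bF b0; apply: bF => i.
by have [j ->|->] := unliftP ord0 i; rewrite ?tnthS// b0.
Qed.

(** At each coordinate one of the two functions is constant; frozen at 0 there, it leaves the
    integral as a factor. *)
Lemma tuple_integral_indep n b (F G : n.-tuple R -> \bar R) :
  measurable_fun setT F -> measurable_fun setT G ->
  (forall x, 0 <= F x) -> (forall x, 0 <= G x) ->
  depends_only b F -> depends_only (fun i => ~~ b i) G ->
  tuple_integral (fun x => F x * G x) =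
  partial_integral b F * partial_integral (fun i => ~~ b i) G.
Proof.
elim: n b F G => [//|n IH] b F G mF mG F0 G0 bF bG /=.
have mPI c H : measurable_fun setT H -> (forall x : n.+1.-tuple R, 0 <= H x) ->
    measurable_fun setT (fun x : R =>
      partial_integral c (fun t => H (cons_tuple x t))).
  move=> mH H0.
  apply: (@measurable_partial_integral _ _ _ _ (fun x t => H (cons_tuple x t))) => //.
  exact: measurable_cons_slice.
have IHx x : tuple_integral (fun t => F (cons_tuple x t) * G (cons_tuple x t)) =
    partial_integral (fun i => b (lift ord0 i)) (fun t => F (cons_tuple x t)) *
    partial_integral (fun i => ~~ b (lift ord0 i)) (fun t => G (cons_tuple x t)).
  apply: IH => //; try exact: measurable_slice.
  - exact: depends_only_cons.
  - exact: (depends_only_cons (b := fun i => ~~ b i)).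
under eq_integral => x _ do rewrite IHx.
case: ifPn => b0 /=.
  under eq_integral => x _.
    have -> : (fun t => G (cons_tuple x t)) = (fun t => G (cons_tuple 0%R t)).
      by apply/funext => t; apply: (depends_only_head _ _ _ bG); rewrite b0.
    over.
  rewrite ge0_integralZr//; first exact: mPI.
    by move=> x _; apply: partial_integral_ge0.
  by apply: partial_integral_ge0.
under eq_integral => x _.
  have -> : (fun t => F (cons_tuple x t)) = (fun t => F (cons_tuple 0%R t)).
    by apply/funext => t; apply: (depends_only_head _ _ _ bF); exact: negbTE.
  over.
rewrite ge0_integralZl//; first exact: mPI.
  by move=> x _; apply: partial_integral_ge0.
by apply: partial_integral_ge0.
Qed.

Lemma tuple_integral_box n (s : 'I_n -> R) (c : R) (F : n.-tuple R -> \bar R) :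
  measurable_fun setT F -> (forall x, 0 <= F x) -> (0 <= c)%R ->
  (forall x, (forall i, s i < tnth x i <= s i + 1)%R -> c%:E <= F x) ->
  c%:E <= tuple_integral F.
Proof.
elim: n s F => [|n IH] s F mF F0 c0 cF /=; first by apply: cF => -[].
apply: (@le_trans _ _ (\int[mu]_(x in `](s ord0), (s ord0 + 1)%R]) c%:E)).
  rewrite integral_cst//= lebesgue_measure_itv/= lte_fin ltrDl ltr01.
  by rewrite -EFinB addrAC subrr add0r mule1.
apply: (@le_trans _ _ (\int[mu]_(x in `](s ord0), (s ord0 + 1)%R])
    tuple_integral (fun t => F (cons_tuple x t)))).
  apply: ge0_le_integral => //.
  - by apply: measurable_funTS; exact: measurable_integral_slice.
  - move=> x; rewrite /= in_itv/= => sx.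
    apply: (IH (fun i => s (lift ord0 i))) => //; first exact: measurable_slice.
    move=> t st; apply: cF => i.
    by have [j ->|->] := unliftP ord0 i; rewrite ?tnthS ?tnth0.
apply: ge0_subset_integral => //; first exact: measurable_integral_slice.
by move=> x _; apply: tuple_integral_ge0.
Qed.

End PartialIntegral.

(** * Gaussian vectors *)

Section GaussianDensity.
Variables (R : realType) (n : nat) (A : 'M[R]_n).
Hypotheses (symA : A^T = A) (posA : posdef_form A).

Definition row_of_tuple (x : n.-tuple R) : 'rV[R]_n := \row_i tnth x i.

Local Notation pdf x := (gaussian_pdf A (row_of_tuple x)).

Lemma gaussian_pdf_ge0 x : 0 <= gaussian_pdf A x.
Proof. by rewrite mulr_ge0// ?expR_ge0// invr_ge0 sqrtr_ge0. Qed.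

Lemma measurable_gaussian_pdf :
  measurable_fun setT (fun x : n.-tuple R => pdf x).
Proof.
apply: measurable_funM => //; apply: measurableT_comp => //.
apply: measurable_funM => //; apply: measurableT_comp => //.
under eq_fun do rewrite row_form_sumE.
apply: measurable_sum => j; apply: measurable_sum => i.
apply: measurable_funM; last first.
  by under eq_fun do rewrite mxE; exact: measurable_tnth.
apply: measurable_funM => //.
by under eq_fun do rewrite mxE; exact: measurable_tnth.
Qed.

Lemma gaussian_pdf_shift (x l : 'rV[R]_n) :
  gaussian_pdf A (x - l *m A) =
  gaussian_pdf A x * expR ((x *m l^T) 0 0 - (l *m A *m l^T) 0 0 / 2).
Proof.
have uA := posdef_unitmx posA.
rewrite /gaussian_pdf mulrAC -expRD; congr (expR _ / _).
have xlx : ((x - l *m A) *m invmx A *m (x - l *m A)^T) 0 0 =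
    (x *m invmx A *m x^T) 0 0 - (x *m l^T) 0 0 *+ 2 + (l *m A *m l^T) 0 0.
  have sub00 (M N : 'M[R]_1) : (M - N) 0 0 = M 0 0 - N 0 0 by rewrite !mxE.
  rewrite mulmxBl mulmxK// linearB/= mulmxBr !mulmxBl !sub00.
  rewrite trmx_mul symA !mulmxA mulmxKV//.
  rewrite (_ : (l *m x^T) 0 0 = (x *m l^T) 0 0); first by ring.
  have -> : l *m x^T = (x *m l^T)^T by rewrite trmx_mul trmxK.
  by rewrite mxE.
rewrite xlx; by field.
Qed.

Lemma row_of_shift_tuple (v : 'rV[R]_n) x :
  row_of_tuple (shift_tuple (fun i => v 0 i) x) = row_of_tuple x + v.
Proof. by apply/rowP => i; rewrite !mxE tnth_mktuple. Qed.

(** Cameron-Martin formula: by [gaussian_pdf_shift] the tilted density is a translate of the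
    density, and the iterated integral is translation invariant. *)
Lemma tilted_integral (l : 'rV[R]_n) (F : n.-tuple R -> R) :
  measurable_fun setT F -> (forall x, 0 <= F x) ->
  tuple_integral (fun x => (F x *
    expR ((row_of_tuple x *m l^T) 0 0 - (l *m A *m l^T) 0 0 / 2) * pdf x)%:E) =
  tuple_integral (fun x =>
    (F (shift_tuple (fun i => (l *m A) 0 i) x) * pdf x)%:E).
Proof.
move=> mF F0.
have E x : F x * expR ((row_of_tuple x *m l^T) 0 0 - (l *m A *m l^T) 0 0 / 2) *
    pdf x = F x * gaussian_pdf A (row_of_tuple x - l *m A).
  by rewrite gaussian_pdf_shift; ring.
under eq_tuple_integral do rewrite E.
rewrite -(tuple_integral_shift (fun i => (l *m A) 0 i)).
- by apply: eq_tuple_integral => x /=; rewrite row_of_shift_tuple addrK.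
- apply/measurable_EFinP; apply: measurable_funM => //.
  have -> : (fun x => gaussian_pdf A (row_of_tuple x - l *m A)) =
      (fun x => pdf x) \o shift_tuple (fun i => (- (l *m A)) 0 i).
    by apply/funext => x; rewrite /= row_of_shift_tuple.
  apply: measurableT_comp; first exact: measurable_gaussian_pdf.
  exact: measurable_shift_tuple.
- by move=> x; rewrite lee_fin mulr_ge0// gaussian_pdf_ge0.
Qed.

(** No determinant is evaluated for this: [gaussian_pdf_total] reads it off the law of a Gaussian
    vector. *)
Hypothesis pdf_total : tuple_integral (fun x => (pdf x)%:E) = 1%E.

(* Chernoff's bound for the linear form [l]. *)
Lemma gaussian_upper_bound (l : 'rV[R]_n) (c : R) (D : set (n.-tuple R)) :
  measurable D -> (forall x, D x -> c <= (row_of_tuple x *m l^T) 0 0) ->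
  (tuple_integral (fun x => (\1_D x * pdf x)%:E) <=
   (expR ((l *m A *m l^T) 0 0 / 2 - c))%:E)%E.
Proof.
move=> mD Dc.
have mdot : measurable_fun setT (fun x : n.-tuple R => (row_of_tuple x *m l^T) 0 0).
  under eq_fun do rewrite mxE; apply: measurable_sum => j.
  apply: measurable_funM => //.
  by under eq_fun do rewrite mxE; exact: measurable_tnth.
pose q := (l *m A *m l^T) 0 0.
have := tilted_integral l (F := fun=> 1) (measurable_cst _) (fun=> ler01).
under [X in _ = X]eq_tuple_integral do rewrite mul1r.
rewrite pdf_total => tilt1.
rewrite -[leRHS]mule1 -tilt1 -tuple_integralZl; last 3 first.
- apply/measurable_EFinP; apply: measurable_funM; last exact: measurable_gaussian_pdf.
  apply: measurable_funM => //; apply: measurableT_comp => //.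
  exact: measurable_funB.
- by move=> x; rewrite lee_fin !mulr_ge0// ?expR_ge0// gaussian_pdf_ge0.
- by rewrite lee_fin expR_ge0.
apply: tuple_integral_le.
- apply/measurable_EFinP; apply: measurable_funM => //.
  exact: measurable_gaussian_pdf.
- apply/measurable_EFinP; apply: measurable_funM => //.
  apply: measurable_funM; last exact: measurable_gaussian_pdf.
  apply: measurable_funM => //; apply: measurableT_comp => //.
  exact: measurable_funB.
- by move=> x; rewrite lee_fin mulr_ge0// gaussian_pdf_ge0.
move=> x; rewrite -EFinM lee_fin mul1r [leRHS]mulrA.
apply: ler_wpM2r; first exact: gaussian_pdf_ge0.
rewrite -expRD indicE; have [|_] := boolP (x \in D); last by rewrite expR_ge0.
rewrite inE => /Dc cx; rewrite -[leLHS]expR0 ler_expR; lra.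
Qed.

(** Were the constant 0, the density would vanish identically, against its total mass 1. *)
Lemma gaussian_peak_gt0 : 0 < (Num.sqrt ((2 * pi) ^+ n * \det A))^-1.
Proof.
rewrite lt_neqAle invr_ge0 sqrtr_ge0 andbT eq_sym; apply/eqP => s0.
move: pdf_total; rewrite /gaussian_pdf s0.
have -> : (fun x : n.-tuple R => (expR (- (row_of_tuple x *m invmx A *m
    (row_of_tuple x)^T) 0 0 / 2) * 0)%:E) = (fun=> 0%:E * 0%:E)%E.
  by apply/funext => x; rewrite mulr0 mule0.
rewrite tuple_integralZl// mul0e => /eqP.
by rewrite eqe eq_sym oner_eq0.
Qed.

Lemma gaussian_lower_bound (s : 'I_n -> R) (q : R) (D : set (n.-tuple R)) :
  measurable D ->
  (forall x, (forall i, s i < tnth x i <= s i + 1) ->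
     D x /\ (row_of_tuple x *m invmx A *m (row_of_tuple x)^T) 0 0 <= q) ->
  ((expR (- q / 2) * (Num.sqrt ((2 * pi) ^+ n * \det A))^-1)%:E <=
   tuple_integral (fun x => (\1_D x * pdf x)%:E))%E.
Proof.
move=> mD Dq.
apply: (tuple_integral_box (s := s)).
- apply/measurable_EFinP; apply: measurable_funM => //.
  exact: measurable_gaussian_pdf.
- by move=> x; rewrite lee_fin mulr_ge0// gaussian_pdf_ge0.
- by rewrite mulr_ge0 ?expR_ge0// ltW ?gaussian_peak_gt0.
move=> x /Dq[Dx qx]; rewrite lee_fin indicE mem_set// mul1r.
rewrite /gaussian_pdf ler_wpM2r ?(ltW gaussian_peak_gt0)// ler_expR.
by lra.
Qed.

End GaussianDensity.

(** * Independence of uncorrelated blocks *)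

Section GaussianIndependence.
Variables (R : realType) (n : nat) (A : 'M[R]_n) (b : 'I_n -> bool).
Hypotheses (uA : A \in unitmx) (blockA : forall i j, b i != b j -> A i j = 0).
Local Notation pdf x := (gaussian_pdf A (row_of_tuple x)).

(** Being block diagonal amounts to commuting with the coordinate projection [E], a property that
    passes to the inverse. *)
Lemma invmx_block i j : b i != b j -> invmx A i j = 0.
Proof.
move=> bij; pose E : 'M[R]_n := diag_mx (\row_k (b k)%:R).
have AE : A *m E = E *m A.
  apply/matrixP => k l; rewrite mul_diag_mx mul_mx_diag !mxE mulrC.
  by have [->//|/blockA ->] := eqVneq (b k) (b l); rewrite !mulr0.
have GE : invmx A *m E = E *m invmx A.
  by rewrite -[LHS]mulmx1 -(mulmxV uA) mulmxA -(mulmxA _ E) -AE mulmxA mulVmx// mul1mx.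
have := congr1 (fun M : 'M[R]_n => M i j) GE.
rewrite mul_diag_mx mul_mx_diag !mxE; move: bij.
by case: (b i); case: (b j) => //= _; rewrite ?mulr0 ?mulr1 ?mul0r ?mul1r.
Qed.

Definition partial_gauss (c : 'I_n -> bool) (x : n.-tuple R) : R :=
  expR (- (\sum_j \sum_i
    if c i && c j then tnth x i * invmx A i j * tnth x j else 0) / 2).

Lemma measurable_partial_gauss c : measurable_fun setT (partial_gauss c).
Proof.
apply: measurableT_comp => //; apply: measurable_funM => //.
apply: measurableT_comp => //.
apply: measurable_sum => j; apply: measurable_sum => i.
case: (c i && c j) => //.
apply: measurable_funM; last exact: measurable_tnth.
by apply: measurable_funM => //; exact: measurable_tnth.
Qed.

Lemma depends_only_partial_gauss c : depends_only c (partial_gauss c).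
Proof.
move=> x y xy; congr (expR (- _ / 2)).
apply: eq_bigr => j _; apply: eq_bigr => i _.
by case: ifP => // /andP[ci cj]; rewrite !xy.
Qed.

Lemma gaussian_pdf_split x : pdf x =
  partial_gauss b x *
  (partial_gauss (fun i => ~~ b i) x * (Num.sqrt ((2 * pi) ^+ n * \det A))^-1).
Proof.
rewrite mulrA -expRD /gaussian_pdf; congr (expR _ / _).
rewrite -mulrDl -opprD -big_split/= row_form_sumE; congr (- _ / 2).
apply: eq_bigr => j _; rewrite -big_split/=; apply: eq_bigr => i _.
rewrite !mxE.
have [bij|bij] := eqVneq (b i) (b j); last first.
  rewrite invmx_block// mulr0 mul0r.
  by case: ifP; case: ifP => *; rewrite addr0.
by rewrite bij; case: (b j); rewrite /= ?addr0 ?add0r.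
Qed.

Hypothesis pdf_total : tuple_integral (fun x => (pdf x)%:E) = 1%E.

(** The density splits into factors on complementary coordinates, so each integral is a product of
    two partial integrals. Their total masses are not computed separately: [one] says that the
    product of these is 1. *)
Lemma gaussian_indep (D1 D2 : set (n.-tuple R)) :
  measurable D1 -> measurable D2 ->
  depends_only b (\1_D1 : n.-tuple R -> R) ->
  depends_only (fun i => ~~ b i) (\1_D2 : n.-tuple R -> R) ->
  (tuple_integral (fun x => (\1_(D1 `&` D2) x * pdf x)%:E) =
   tuple_integral (fun x => (\1_D1 x * pdf x)%:E) *
   tuple_integral (fun x => (\1_D2 x * pdf x)%:E))%E.
Proof.
move=> mD1 mD2 bD1 bD2.
pose N := (Num.sqrt ((2 * pi) ^+ n * \det A))^-1.
have N0 : 0 <= N by rewrite invr_ge0 sqrtr_ge0.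
pose F D x := (\1_D x * partial_gauss b x)%:E.
pose G D x := (\1_D x * (partial_gauss (fun i => ~~ b i) x * N))%:E.
have FG D E : measurable D -> measurable E ->
    depends_only b (\1_D : n.-tuple R -> R) ->
    depends_only (fun i => ~~ b i) (\1_E : n.-tuple R -> R) ->
    (tuple_integral (fun x => (\1_(D `&` E) x * pdf x)%:E) =
     partial_integral b (F D) * partial_integral (fun i => ~~ b i) (G E))%E.
  move=> mD mE bD bE.
  rewrite -tuple_integral_indep.
  - apply: eq_tuple_integral => x; rewrite -EFinM gaussian_pdf_split indicI /=.
    by congr EFin; rewrite -/N; ring.
  - apply/measurable_EFinP; apply: measurable_funM => //.
    exact: measurable_partial_gauss.
  - apply/measurable_EFinP; apply: measurable_funM => //.
    by apply: measurable_funM => //; exact: measurable_partial_gauss.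
  - by move=> x; rewrite lee_fin mulr_ge0// expR_ge0.
  - by move=> x; rewrite lee_fin !mulr_ge0// expR_ge0.
  - by move=> x y xy; rewrite /F (bD _ _ xy) (depends_only_partial_gauss xy).
  - by move=> x y xy; rewrite /G (bE _ _ xy) (depends_only_partial_gauss xy).
have bT c : depends_only c (\1_[set: n.-tuple R] : n.-tuple R -> R).
  by move=> x y _; rewrite !indicE !in_setT.
have := FG _ _ (measurableT) (measurableT) (bT _) (bT _).
rewrite setTI; under [X in X = _ -> _]eq_tuple_integral do rewrite indicE in_setT mul1r.
rewrite pdf_total => one.
have := FG _ _ mD1 measurableT bD1 (bT _); rewrite setIT => ->.
have := FG _ _ measurableT mD2 (bT _) bD2; rewrite setTI => ->.
rewrite FG// [X in _ = (_ * X)%E]muleC muleACA [X in _ = (_ * X)%E]muleC.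
by rewrite -one mule1.
Qed.

End GaussianIndependence.

(** * Laws of single coordinates *)

Section GaussianVector.
Context d (T : measurableType d) (R : realType) (P : probability T R) (n : nat).
Variables (X : 'I_n -> {RV P >-> R}) (A : 'M[R]_n).
Hypothesis gaussX : gaussian_vector X A.

Let symA : A^T = A. Proof. by case: gaussX => -[]. Qed.
Let posA : posdef_form A. Proof. by case: gaussX => -[]. Qed.

Local Notation pdf x := (gaussian_pdf A (row_of_tuple x)).

Lemma gaussian_law D : measurable D ->
  P [set w | D [tuple X i w | i < n]] =
  tuple_integral (fun x => (\1_D x * pdf x)%:E).
Proof. by case: gaussX => _; exact. Qed.

Lemma gaussian_pdf_total : tuple_integral (fun x => (pdf x)%:E) = 1%E.
Proof.
have := gaussian_law measurableT.
rewrite (_ : [set w | _] = setT); last by apply/seteqP.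
rewrite probability_setT => ->.
by apply: eq_tuple_integral => x; rewrite indicE in_setT mul1r.
Qed.

Lemma normal_pdf_tilt (y t : R) :
  normal_pdf y 1 t = normal_pdf 0 1 y * expR (t * y - t ^+ 2 / 2).
Proof.
rewrite !normal_pdfE ?oner_eq0// /normal_fun -mulrA -expRD.
by congr (_ * expR _); field.
Qed.

(* Multiply the density by [1 = \int_t normal_pdf y 1 t], where [y] is the
   standardized coordinate: by [normal_pdf_tilt] this is an exponential tilt,
   that is, a translation of the Gaussian vector which moves [y] to [y + t].
   Tonelli then leaves the Lebesgue integral of [t |-> 1_D (y + t) phi (y + t)],
   which does not depend on the vector. *)
Lemma standardized_law i s D : 0 < s -> s ^+ 2 = A i i -> measurable D ->
  P [set w | D (X i w / s)] = normal_prob 0 1 D.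
Proof.
move=> s0 sA mD.
pose y (x : n.-tuple R) := tnth x i / s.
have my : measurable_fun setT y.
  by apply: measurable_funM => //; exact: measurable_tnth.
pose f (r : R) : R := \1_D r * normal_pdf 0 1 r.
have mf : measurable_fun setT f.
  by apply: measurable_funM => //; exact: measurable_normal_pdf.
have f0 r : 0 <= f r by rewrite mulr_ge0// normal_pdf_ge0.
have mpdf := @measurable_gaussian_pdf R n A.
(* Scaled so that translating by [l t *m A] adds [t] to [y], at the quadratic cost [t ^+ 2]. *)
pose l t : 'rV[R]_n := (t / s) *: delta_mx 0 i.
have lA t j : (l t *m A) 0 j = t / s * A i j.
  by rewrite -scalemxAl -rowE !mxE.
have lAl t : (l t *m A *m (l t)^T) 0 0 = t ^+ 2.
  rewrite row_formE (bigD1 i)//= big1 ?addr0 => [|j ji].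
    by rewrite lA !mxE !eqxx /= mulr1 -sA; field; rewrite gt_eqF.
  by rewrite !mxE (negbTE ji) andbF !mulr0.
have dot t x : (row_of_tuple x *m (l t)^T) 0 0 = t * y x.
  rewrite mxE (bigD1 i)//= big1 ?addr0 => [|j ji].
    by rewrite !mxE !eqxx /= mulr1 /y; field; rewrite gt_eqF.
  by rewrite !mxE (negbTE ji) andbF !mulr0.
have yshift t x : y (shift_tuple (fun j => (l t *m A) 0 j) x) = y x + t.
  by rewrite /y tnth_mktuple lA -sA; field; rewrite gt_eqF.
have mysnd : measurable_fun setT (fun z : R * n.-tuple R => y z.2).
  exact: (measurableT_comp my measurable_snd).
have mpsnd : measurable_fun setT (fun z : R * n.-tuple R => pdf z.2).
  exact: (measurableT_comp mpdf measurable_snd).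
transitivity (tuple_integral (fun x => (\1_D (y x) * pdf x)%:E)).
  rewrite -(gaussian_law (D := [set x | D (y x)])) => [|].
    congr (P _); apply/seteqP; split => w /=; by rewrite /y tnth_mktuple.
  by rewrite -[X in measurable X]setTI; exact: my.
transitivity (tuple_integral (fun x => (\int[lebesgue_measure]_t
    (f (y x) * expR (t * y x - t ^+ 2 / 2) * pdf x)%:E)%E)).
  apply: eq_tuple_integral => x.
  have -> : (fun t => (f (y x) * expR (t * y x - t ^+ 2 / 2) * pdf x)%:E) =
      (fun t => (\1_D (y x) * pdf x)%:E * (normal_pdf (y x) 1 t)%:E)%E.
    by apply/funext => t; rewrite -EFinM normal_pdf_tilt /f; congr EFin; ring.
  rewrite ge0_integralZl_EFin//.
  - by rewrite integral_normal_pdf mule1.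
  - by move=> t _; rewrite lee_fin normal_pdf_ge0.
  - by apply/measurable_EFinP; exact: measurable_normal_pdf.
  - by rewrite mulr_ge0// gaussian_pdf_ge0.
rewrite -(tuple_integral_swap
  (F := fun t x => (f (y x) * expR (t * y x - t ^+ 2 / 2) * pdf x)%:E)); last 2 first.
- apply/measurable_EFinP; apply: measurable_funM => //.
  apply: measurable_funM.
    exact: (measurableT_comp mf mysnd).
  apply: measurableT_comp => //; apply: measurable_funB.
    by apply: measurable_funM.
  apply: measurable_funM => //.
  exact: measurable_funX.
- by move=> t x; rewrite lee_fin mulr_ge0 ?gaussian_pdf_ge0// mulr_ge0 ?expR_ge0.
under eq_integral => t _.
  have := tilted_integral symA posA (l t) (F := f \o y)
    (measurableT_comp mf my) (fun=> f0 _).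
  rewrite lAl; under [X in X = _ -> _]eq_tuple_integral do rewrite dot.
  move=> ->; under eq_tuple_integral do rewrite /= yshift.
  over.
rewrite (tuple_integral_swap (F := fun t x => (f (y x + t) * pdf x)%:E)); last 2 first.
- apply/measurable_EFinP; apply: measurable_funM => //.
  by apply: (measurableT_comp mf); apply: measurable_funD.
- by move=> t x; rewrite lee_fin mulr_ge0 ?gaussian_pdf_ge0 ?f0.
have If0 : (0 <= \int[lebesgue_measure]_t (f t)%:E)%E.
  by apply: integral_ge0 => t _; rewrite lee_fin.
transitivity (tuple_integral (fun x =>
    ((\int[lebesgue_measure]_t (f t)%:E) * (pdf x)%:E)%E)).
  apply: eq_tuple_integral => x.
  transitivity (\int[@lebesgue_measure R]_t ((f (t + y x)%R)%:E * (pdf x)%:E))%E.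
    by apply: eq_integral => t _; rewrite -EFinM addrC.
  have mfE : measurable_fun setT (fun t => (f t)%:E) by exact/measurable_EFinP.
  have mfy : measurable_fun setT (fun t : R => (f (t + y x))%:E).
    by apply/measurable_EFinP; apply: (measurableT_comp mf); exact: measurable_funD.
  have fE0 t : (0 <= (f t)%:E)%E by rewrite lee_fin.
  have p0 : (0 <= (pdf x)%:E)%E by rewrite lee_fin gaussian_pdf_ge0.
  transitivity ((\int[@lebesgue_measure R]_t (f (t + y x)%R)%:E) * (pdf x)%:E)%E.
    by apply: ge0_integralZr; [exact: measurableT|exact: mfy|move=> t _; exact: fE0|].
  exact: (congr1 (fun z => z * (pdf x)%:E)%E (integral_shift (y x) mfE fE0)).
rewrite tuple_integralZl//; last 2 first.
- exact/measurable_EFinP.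
- by move=> x; rewrite lee_fin gaussian_pdf_ge0.
rewrite gaussian_pdf_total mule1 /normal_prob [RHS]integral_mkcond.
apply: eq_integral => t _; rewrite patchE /f indicE.
by case: (t \in D); rewrite ?mul1r ?mul0r.
Qed.

Lemma standardized_moment i j s t : 0 < s -> s ^+ 2 = A i i ->
  0 < t -> t ^+ 2 = A j j ->
  (\int[P]_w ((X i w / s) ^+ 2)%:E = \int[P]_w ((X j w / t) ^+ 2)%:E)%E.
Proof.
move=> s0 sA t0 tA.
have mY k r : measurable_fun setT (fun w => X k w / r) by apply: measurable_funM.
pose Y k r : {mfun T >-> R} :=
  HB.pack (fun w => X k w / r) (isMeasurableFun.Build _ _ _ _ _ (mY k r)).
have msqr : measurable_fun setT (fun y : R => (y ^+ 2)%:E).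
  by apply/measurable_EFinP; exact: measurable_funX.
have momentE k r : (\int[P]_w ((X k w / r) ^+ 2)%:E =
    \int[pushforward P (Y k r)]_(y in [set: R]) (y ^+ 2)%:E)%E.
  by rewrite ge0_integral_pushforward// => y _; rewrite lee_fin sqr_ge0.
rewrite !momentE; apply: eq_measure_integral => D mD _.
have := standardized_law s0 sA mD; have := standardized_law t0 tA mD.
by move=> <-.
Qed.

Lemma integral_sqr_scale i s : 0 < s ->
  (\int[P]_w ((X i w) ^+ 2)%:E =
   (s ^+ 2)%:E * \int[P]_w ((X i w / s) ^+ 2)%:E)%E.
Proof.
move=> s0; rewrite -ge0_integralZl_EFin ?sqr_ge0//.
- apply: eq_integral => w _; rewrite -EFinM; congr EFin.
  by field; rewrite gt_eqF.
- by move=> w _; rewrite lee_fin sqr_ge0.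
- apply/measurable_EFinP; apply: measurable_funX.
  exact: measurable_funM.
Qed.

Lemma standard_second_moment i : standard X ->
  (\int[P]_w ((X i w) ^+ 2)%:E = 1)%E.
Proof.
move=> /(_ i)[EX <-]; rewrite /variance covariance.unlock EX /= expectation_def.
by apply: eq_integral => w _; rewrite /= subr0 expr2.
Qed.

(** The standardized coordinates share one second moment, and [A i i] times it is 1 for every [i].
    Its value is not computed: it cancels. *)
Lemma standard_diag i j : standard X -> A i i = A j j.
Proof.
move=> stdX.
have h k : exists2 s, 0 < s & s ^+ 2 = A k k.
  exists (Num.sqrt (A k k)); first by rewrite sqrtr_gt0 posdef_diag.
  by rewrite sqr_sqrtr// ltW// posdef_diag.
have [s s0 sA] := h i; have [t t0 tA] := h j.
have := standard_second_moment j stdX; have := standard_second_moment i stdX.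
rewrite (integral_sqr_scale _ s0) (integral_sqr_scale _ t0) -sA -tA.
rewrite (standardized_moment s0 sA t0 tA).
have s20 : 0 < s ^+ 2 by rewrite exprn_gt0.
have t20 : 0 < t ^+ 2 by rewrite exprn_gt0.
case: (\int[P]_w _)%E => [r||].
- rewrite -!EFinM => -[sr] [tr].
  have r0 : r != 0 by apply/eqP => r0; move/eqP: sr; rewrite r0 mulr0 eq_sym oner_eq0.
  by apply: (mulIf r0); rewrite sr tr.
- by rewrite gt0_muley ?lte_fin.
- by rewrite gt0_muleNy ?lte_fin.
Qed.

Lemma exceedance_eq i j h : standard X ->
  P [set w | h < X i w] = P [set w | h < X j w].
Proof.
move=> stdX; have [s s0 sA] : exists2 s, 0 < s & s ^+ 2 = A i i.
  exists (Num.sqrt (A i i)); first by rewrite sqrtr_gt0 posdef_diag.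
  by rewrite sqr_sqrtr// ltW// posdef_diag.
have law k : A k k = s ^+ 2 ->
    P [set w | h < X k w] = normal_prob 0 1 `](h / s)%R, +oo[%classic.
  move=> Ak; rewrite -(standardized_law s0 (esym Ak)) //; congr (P _).
  by apply/seteqP; split=> w /=; rewrite in_itv/= andbT ltr_pM2r ?invr_gt0.
by rewrite !law// sA; apply: standard_diag.
Qed.

End GaussianVector.

(** * Color representations for large thresholds *)

Section BooleanProcess.
Context d (T : measurableType d) (R : realType) (P : probability T R).
Variables (I : finType) (Y : I -> T -> bool).
Hypothesis mY : forall i, measurable [set w | Y i w].
Implicit Types (S Z U : {set I}).

Definition process_law Z : R := fine (P [set w | forall i, Y i w = (i \in Z)]).

Lemma measurable_finite_forall (E : I -> set T) :
  (forall i, measurable (E i)) -> measurable [set w | forall i, E i w].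
Proof.
move=> mE; rewrite (_ : mkset _ = \bigcap_(i in setT) E i).
  by apply: fin_bigcap_measurable => // i _; exact: mE.
by apply/seteqP; split=> w h i //; exact: h.
Qed.

Lemma measurable_atom Z : measurable [set w | forall i, Y i w = (i \in Z)].
Proof.
apply: (measurable_finite_forall (E := fun i => [set w | Y i w = (i \in Z)])) => i.
have [iZ|iZ] := boolP (i \in Z).
  by rewrite (_ : mkset _ = [set w | Y i w]).
rewrite (_ : mkset _ = ~` [set w | Y i w]); first exact: measurableC.
by apply/seteqP; split=> w /=; [move=> ->|case: (Y i w)].
Qed.

Lemma process_law_ge0 Z : 0 <= process_law Z.
Proof. by rewrite fine_ge0. Qed.

Lemma process_lawE Z :
  P [set w | forall i, Y i w = (i \in Z)] = (process_law Z)%:E.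
Proof. by rewrite fineK// fin_num_measure//; exact: measurable_atom. Qed.

Lemma upper_sum_law S :
  P [set w | forall i, i \in S -> Y i w] = (upper_sum process_law S)%:E.
Proof.
rewrite /upper_sum -sumEFin.
under eq_bigr do rewrite -process_lawE.
pose atom Z := [set w | forall i, Y i w = (i \in Z)].
transitivity (P (\bigcup_(Z in [set` (fun Z : {set I} => S \subset Z)]) atom Z)).
  congr (P _); apply/seteqP; split=> [w Sw|w [Z /= SZ Zw] i iS].
    exists [set i | Y i w]%SET; last by move=> i; rewrite inE.
    change (S \subset [set i | Y i w]%SET).
    by apply/fintype.subsetP => i /Sw; rewrite inE.
  by rewrite Zw (fintype.subsetP (SZ : S \subset Z)).
rewrite measure_fin_bigcup//; last 2 first.
- apply/trivIsetP => Z Z' _ _ ZZ'; apply/seteqP; split=> w //= -[wZ wZ'].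
  by move/eqP: ZZ'; apply; apply/setP => i; rewrite -wZ wZ'.
- by move=> Z _; exact: measurable_atom.
by rewrite [RHS]bigfs ?index_enum_uniq// => Z _; rewrite mem_index_enum.
Qed.

Lemma upper_sum_law_total : upper_sum process_law finset.set0 = 1.
Proof.
apply: EFin_inj; rewrite -upper_sum_law (_ : [set w | _] = setT) ?probability_setT//.
by apply/seteqP; split=> w //= _ i; rewrite inE.
Qed.

(** Different sets [U] may induce the same partition, so the weights are summed over the fibres of
    [trace_partition Q]. *)
Lemma color_process_trace_mixture (p : R) (Q : {set {set I}}) (W : {set I} -> R) :
  0 <= p <= 1 -> finset.partition Q [set: I]%SET ->
  (forall U, 0 <= W U) -> \sum_U W U = 1 ->
  (forall Z, \sum_U W U * coloring_law p (trace_partition Q U) Z = process_law Z) ->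
  color_process P Y.
Proof.
move=> p01 partQ W0 W1 mix.
exists p, (fun pi => \sum_(U | trace_partition Q U == pi) W U); split => //.
- split=> [pi|pi npi|].
  + exact: sumr_ge0.
  + rewrite big_pred0// => U; apply/negP => /eqP piU.
    by move/negP: npi; apply; rewrite -piU; exact: trace_partitionP.
  + by rewrite -W1 (partition_big (trace_partition Q) xpredT).
move=> y; pose Z := [set i | y i]%SET.
rewrite (_ : [set w | _] = [set w | forall i, Y i w = (i \in Z)]); last first.
  by apply/seteqP; split=> w h i; have := h i; rewrite inE.
rewrite process_lawE -mix; congr EFin.
rewrite (partition_big (trace_partition Q) xpredT)//=; apply: eq_bigr => pi _.
by rewrite big_distrl/=; apply: eq_bigr => U /eqP <-.
Qed.

End BooleanProcess.

Lemma bernoulli_moment_gt0 (R : realFieldType) (p : R) m :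
  0 < p -> p < 1 / 2 -> (1 < m)%N -> 0 < bernoulli_moment p m.
Proof.
move=> p0 p2; case: m => [//|m]; rewrite ltnS => m0.
have q0 : 0 < 1 - p by lra.
have -> : bernoulli_moment p m.+1 = p * (1 - p) * ((1 - p) ^+ m - (- p) ^+ m).
  by rewrite /bernoulli_moment !exprS; ring.
rewrite !mulr_gt0// subr_gt0; apply: (@le_lt_trans _ _ (p ^+ m)).
  by apply: le_trans (ler_norm _) _; rewrite normrX normrN gtr0_norm.
by rewrite ltrXn2r -?lt0n ?(ltW p0)//; lra.
Qed.

(** * Comparisons valid for all large heights *)

Section Eventually.
Variable R : realType.

Lemma eventually_forall (I : finType) (Q : I -> R -> Prop) :
  (forall i, exists h0, forall h, h0 <= h -> Q i h) ->
  exists h0, forall h, h0 <= h -> forall i, Q i h.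
Proof.
move=> /choice[f fQ]; exists (\sum_i `|f i|) => h fh i; apply: fQ.
apply: le_trans fh; rewrite (bigD1 i)//=; apply: le_trans (ler_norm _) _.
by rewrite lerDl sumr_ge0.
Qed.

Lemma eventually_gauss_le (e e' c C eps : R) : 0 < c -> 0 < eps -> e < e' ->
  exists h0, forall h, h0 <= h ->
    expR (- (h ^+ 2 * e') / 2) <= eps * (c * expR (- (h ^+ 2 * e) / 2 - C * h)).
Proof.
move=> c0 eps0 ee; pose L := ln (eps * c); pose D := e' - e.
have D0 : 0 < D by rewrite subr_gt0.
(* With [h] at least 1, half of [h ^+ 2 * D] is at least [h * (]|C| + [|L|)], hence at least
   [C * h - L]. *)
exists (Num.max 1 (2 * (`|C| + `|L|) / D)) => h; rewrite ge_max => /andP[h1].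
rewrite ler_pdivrMr// => hD.
rewrite mulrA -[eps * c]lnK ?posrE ?mulr_gt0// -expRD ler_expR -/L.
have C1 := ler_norm C; have L1 : - L <= `|L| by rewrite -normrN ler_norm.
have h0 : 0 <= h by lra.
have : h * (`|C| + `|L|) <= h * (h * D / 2) by rewrite ler_wpM2l//; lra.
have : C * h <= `|C| * h by rewrite ler_wpM2r.
have : 1 * `|L| <= h * `|L| by rewrite ler_wpM2r.
have -> : e' = e + D by rewrite /D; ring.
rewrite expr2 mulrDr; lra.
Qed.

End Eventually.

(** * Exceedance probabilities at height [h] *)

Section ThresholdGaussian.
Context d (T : measurableType d) (R : realType) (P : probability T R) (n : nat).
Variables (X : 'I_n -> {RV P >-> R}) (A : 'M[R]_n).
Hypothesis gaussX : gaussian_vector X A.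
Implicit Types (S Z B : {set 'I_n}).

Let symA : A^T = A. Proof. by case: gaussX => -[]. Qed.
Let posA : posdef_form A. Proof. by case: gaussX => -[]. Qed.

Local Notation law h := (process_law P (threshold X h)).

Lemma measurable_threshold h i : measurable [set w | threshold X h i w].
Proof.
rewrite (_ : mkset _ = X i @^-1` `]h, +oo[%classic).
  by rewrite -[X in measurable X]setTI; exact: measurable_funP.
by apply/seteqP; split=> w; rewrite /threshold/= in_itv/= andbT.
Qed.

Lemma measurable_tuple_forall (E : 'I_n -> set R) :
  (forall i, measurable (E i)) ->
  measurable [set x : n.-tuple R | forall i, E i (tnth x i)].
Proof.
move=> mE.
apply: (measurable_finite_forall (E := fun i => [set x : n.-tuple R | E i (tnth x i)])) => i.
by rewrite -[X in measurable X]setTI; exact: measurable_tnth.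
Qed.

Definition tuple_orthant h S : set (n.-tuple R) :=
  [set x | forall i, i \in S -> h < tnth x i].

Lemma measurable_tuple_orthant h S : measurable (tuple_orthant h S).
Proof.
apply: (measurable_tuple_forall (E := fun i => [set r : R | i \in S -> h < r])) => i.
have [iS|iS] := boolP (i \in S).
  rewrite (_ : mkset _ = `]h, +oo[%classic)//.
  by apply/seteqP; split=> r /=; rewrite in_itv/= andbT // => /(_ isT).
by rewrite (_ : mkset _ = setT)//; apply/seteqP; split=> r.
Qed.

Lemma upper_sum_gauss h S : (upper_sum (law h) S)%:E =
  tuple_integral (fun x =>
    (\1_(tuple_orthant h S) x * gaussian_pdf A (row_of_tuple x))%:E).
Proof.
rewrite -upper_sum_law; last exact: measurable_threshold.
rewrite -(gaussian_law gaussX (measurable_tuple_orthant h S)).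
congr (P _); apply/seteqP; split=> w Sw i iS.
  by rewrite tnth_mktuple; exact: Sw.
by have := Sw i iS; rewrite tnth_mktuple.
Qed.

Lemma equilibrium_form S l : equilibrium A S l ->
  (l *m A *m l^T) 0 0 = energy l.
Proof.
move=> [l0 lS lA _]; rewrite row_formE; apply: eq_bigr => j _.
have [jS|jS] := boolP (j \in S); first by rewrite lA// mul1r.
by rewrite lS// mulr0.
Qed.

(** Chernoff's bound for the form [h *: l]: on the orthant it is at least [h ^+ 2 * energy l], and
    the Gaussian exponent gives half of this back. *)
Lemma upper_sum_le h S l : 0 <= h -> equilibrium A S l ->
  upper_sum (law h) S <= expR (- (h ^+ 2 * energy l) / 2).
Proof.
move=> h0 eqS; have [l0 lS _ _] := eqS.
rewrite -lee_fin upper_sum_gauss.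
apply: (@le_trans _ _ (expR (((h *: l) *m A *m (h *: l)^T) 0 0 / 2
    - h ^+ 2 * energy l))%:E).
  apply: gaussian_upper_bound => //.
  - exact: (gaussian_pdf_total gaussX).
  - exact: measurable_tuple_orthant.
  move=> x Sx; rewrite mxE /energy big_distrr/=; apply: ler_sum => j _.
  rewrite !mxE; have [jS|jS] := boolP (j \in S); last first.
    by rewrite lS// !mulr0.
  rewrite expr2 -mulrA; apply: ler_wpM2r; first by rewrite mulr_ge0.
  exact: ltW (Sx j jS).
by rewrite lee_fin ler_expR row_formZ (equilibrium_form eqS); lra.
Qed.

(* Bound the density from below on a unit box with a corner at [h *: (l *m A)],
   the conditional mean of the vector given that it equals [h] on [S]. *)
Lemma process_law_ge S l : equilibrium A S l ->
  exists2 c, 0 < c & forall h, 0 <= h ->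
    c * expR (- (h ^+ 2 * energy l) / 2 - energy l * h) <= law h S.
Proof.
move=> eqS; have [l0 lS lA l1] := eqS.
have total := gaussian_pdf_total gaussX.
have N0 := gaussian_peak_gt0 total.
pose N := (Num.sqrt ((2 * pi) ^+ n * \det A))^-1.
(* [K] bounds the form of [invmx A] at every vector with entries in [-1, 1], such as the
   displacement [v] below. *)
pose K := \sum_j \sum_i `|invmx A i j|.
exists (expR (- K / 2) * N) => [|h h0]; first by rewrite mulr_gt0// expR_gt0.
pose D := [set x : n.-tuple R | forall i, (h < tnth x i) = (i \in S)].
have mD : measurable D.
  apply: (measurable_tuple_forall (E := fun i => [set r : R | (h < r) = (i \in S)])) => i.
  have [iS|iS] := boolP (i \in S).
    rewrite (_ : mkset _ = `]h, +oo[%classic)//.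
    by apply/seteqP; split=> r /=; rewrite in_itv/= andbT.
  rewrite (_ : mkset _ = `]-oo, h]%classic)//.
  by apply/seteqP; split=> r /=; rewrite in_itv/= leNgt; [move=> ->|move=> /negbTE].
rewrite -lee_fin -process_lawE; last exact: measurable_threshold.
have -> : P [set w | forall i, threshold X h i w = (i \in S)] =
    P [set w | D [tuple X i w | i < n]].
  by congr (P _); apply/seteqP; split=> w h' i; have := h' i; rewrite tnth_mktuple.
rewrite (gaussian_law gaussX mD).
pose q := h ^+ 2 * energy l + 2 * h * energy l + K.
rewrite [X in (X%:E <= _)%E](_ : _ = expR (- q / 2) * N); last first.
  rewrite mulrAC -expRD; congr (expR _ * _); rewrite /q; by field.
(* For [i] in [S] the side of the box starts at [h]. For the others it ends at [h * (l *m A) 0 i],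
   which is at most [h], so these coordinates do not exceed [h]. *)
pose s i := h * (l *m A) 0 i - (i \notin S)%:R.
apply: (gaussian_lower_bound total (s := s)) => // x sx.
pose v : 'rV[R]_n := row_of_tuple x - h *: (l *m A).
have vE i : v 0 i = tnth x i - h * (l *m A) 0 i by rewrite !mxE.
have vbound i : `|v 0 i| <= 1.
  rewrite vE ler_norml; move: (sx i); rewrite /s.
  by case: (i \in S) => /= /andP[h1 h2]; apply/andP; split; lra.
split=> [i|].
  have := sx i; rewrite /s; have [iS|iS] := boolP (i \in S) => /=.
    by rewrite lA// mulr1 subr0 => /andP[].
  move=> /andP[_]; rewrite subrK => xi; apply/negbTE; rewrite -leNgt.
  by apply: le_trans xi _; rewrite -[leRHS]mulr1 ler_wpM2l.
have uA := posdef_unitmx posA.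
have symG : (invmx A)^T = invmx A by rewrite trmx_inv symA.
have -> : row_of_tuple x = h *: (l *m A) + v by rewrite addrC subrK.
rewrite (row_formD _ _ symG) row_formZ row_formZl mulmxK//.
have -> : (l *m (l *m A)^T) 0 0 = energy l.
  by rewrite trmx_mul symA mulmxA (equilibrium_form eqS).
have lv : (l *m v^T) 0 0 <= energy l.
  rewrite mxE; apply: ler_sum => j _; rewrite [v^T _ _]mxE.
  rewrite -[leRHS]mulr1 ler_wpM2l//.
  exact: le_trans (ler_norm _) (vbound j).
have vv : (v *m invmx A *m v^T) 0 0 <= K.
  rewrite row_form_sumE; apply: ler_sum => j _; apply: ler_sum => i _.
  apply: le_trans (ler_norm _) _; rewrite !normrM.
  rewrite -[leRHS]mulr1 -[leRHS]mul1r mulrA !ler_pM ?mulr_ge0//.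
have : h * (l *m v^T) 0 0 <= h * energy l by rewrite ler_wpM2l.
by rewrite /q; lra.
Qed.

Lemma upper_sum_indep h B S :
  (forall i j, (i \in B) != (j \in B) -> A i j = 0) ->
  upper_sum (law h) S =
  upper_sum (law h) (S :&: B) * upper_sum (law h) (S :\: B).
Proof.
move=> blockA; apply: EFin_inj; rewrite EFinM !upper_sum_gauss.
rewrite -(gaussian_indep (posdef_unitmx posA) blockA); last 5 first.
- exact: (gaussian_pdf_total gaussX).
- exact: measurable_tuple_orthant.
- exact: measurable_tuple_orthant.
- move=> x y xy; rewrite !indicE; congr (nat_of_bool _)%:R.
  by apply/idP/idP => /set_mem h'; apply/mem_set => i iSB;
    have := h' i iSB; rewrite xy//; move: iSB; rewrite inE => /andP[].
- move=> x y xy; rewrite !indicE; congr (nat_of_bool _)%:R.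
  by apply/idP/idP => /set_mem h'; apply/mem_set => i iSB;
    have := h' i iSB; rewrite xy//; move: iSB; rewrite inE => /andP[].
congr tuple_integral; apply/funext => x; congr (_ * _)%:E.
congr (\1__ _); apply/seteqP; split=> {x} x.
  by move=> Sx; split=> i; rewrite inE => /andP[] *; exact: Sx.
move=> [h1 h2] i iS; have [iB|iB] := boolP (i \in B).
  by apply: h1; rewrite inE iS.
by apply: h2; rewrite inE iS iB.
Qed.

Lemma upper_sum_set1 h i :
  (upper_sum (law h) [set i]%SET)%:E = P [set w | h < X i w].
Proof.
rewrite -upper_sum_law; last exact: measurable_threshold.
congr (P _); apply/seteqP; split=> w /=.
  by move=> /(_ i); rewrite inE eqxx; apply.
by move=> hi j; rewrite inE => /eqP ->.
Qed.

End ThresholdGaussian.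

Lemma dgff_blocks (R : realType) (n : nat) (A : 'M[R]_n) (Q : {set {set 'I_n}}) :
  finset.partition Q [set: 'I_n]%SET ->
  (forall i j, j \in finset.pblock Q i -> 0 < A i j) ->
  (forall i j, j \notin finset.pblock Q i -> A i j = 0) ->
  [/\ forall i j, 0 <= A i j,
      forall B i j, B \in Q -> i \in B -> j \in B -> 0 < A i j &
      forall B i j, B \in Q -> (i \in B) != (j \in B) -> A i j = 0].
Proof.
move=> partQ Apos A0; have [/eqP covQ trivQ _] := and3P partQ.
split=> [i j|B i j BQ iB jB|B i j BQ].
- by have [/Apos/ltW//|/A0 ->] := boolP (j \in finset.pblock Q i).
- by apply: Apos; rewrite (finset.def_pblock trivQ BQ iB).
have [iB|iB] := boolP (i \in B) => /= jB.
  by apply: A0; rewrite (finset.def_pblock trivQ BQ iB); case: (j \in B) jB.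
have {}jB : j \in B by case: (j \in B) jB.
apply: A0; apply: contra iB => jQi.
have Qi : finset.pblock Q i \in Q by rewrite finset.pblock_mem// covQ inE.
rewrite -(finset.def_pblock trivQ BQ jB) (finset.def_pblock trivQ Qi jQi).
by rewrite finset.mem_pblock covQ inE.
Qed.

Theorem theorem1p5 (d : measure_display) (T : measurableType d)
    (R : realType) (P : probability T R) (n : nat)
    (X : 'I_n -> {RV P >-> R}) :
  dgff X -> standard X ->
  exists h0 : R, forall h : R, h0 <= h -> color_process P (threshold X h).
Proof.
move=> [A gaussX [Q [partQ [[Apos A0] offG rowG _]]]] stdX.
have [[symA posA] _] := gaussX.
have [Age0 Ablock Across] := dgff_blocks partQ Apos A0.
have [l eql] := choice (fun S => equilibrium_exists S symA posA offG rowG).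
(* The common variance; the value 1 serves only the empty index set. *)
have [a a0 diagA] : exists2 a, 0 < a & forall i, A i i = a.
  have [i0|no_i] := pickP 'I_n; last by exists 1 => // i; have := no_i i.
  exists (A i0 i0); first exact: posdef_diag.
  by move=> ?; apply: (standard_diag gaussX).
pose K : R := 2 ^+ #|'I_n|.
have K1 : 1 <= K by exact: powK_ge1.
pose eps : R := (4 * K ^+ 3)^-1.
have K3 : 1 <= K ^+ 3 by rewrite exprn_ege1.
have eps0 : 0 < eps by rewrite invr_gt0; lra.
have eps_le : 4 * K ^+ 3 * eps <= 1 by rewrite mulfV// gt_eqF//; lra.
have eps2 : eps <= 1 / 4.
  have : eps <= K ^+ 3 * eps by rewrite ler_peMl// ltW.
  by lra.
pose law h := process_law P (threshold X h).
pose marg h i := upper_sum (law h) [set i]%SET.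
have marg_le h i : 0 <= h -> marg h i <= expR (- (h ^+ 2 * (1 / a)) / 2).
  move=> h0; rewrite -(energy_set1 a0 (diagA i) (eql _)).
  exact: (upper_sum_le gaussX).
have [h1 small_marg] : exists h0, forall h, h0 <= h ->
    expR (- (h ^+ 2 * (1 / a)) / 2) <= eps.
  have [|h0 h0P] := @eventually_gauss_le R 0 (1 / a) 1 0 eps ltr01 eps0.
    by rewrite divr_gt0.
  exists h0 => h /h0P; rewrite mulr0 oppr0 mul0r mul0r subrr expR0.
  by rewrite !mulr1.
(* [marg h i] stands for [p], which is introduced only after [h] is fixed. Combinations that violate
   a premise get the threshold 0. *)
have [h2 dominated] : exists h0, forall h, h0 <= h ->
    forall (i : 'I_n) (B V W S : {set 'I_n}),
      B \in Q -> V \subset W -> W \subset B -> (1 < #|V|)%N ->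
      S != finset.set0 -> S \proper W -> 0 <= h ->
      marg h i ^+ #|W :\: S| * upper_sum (law h) S <= eps * law h V.
  apply: eventually_forall => i; apply: eventually_forall => B.
  apply: eventually_forall => V; apply: eventually_forall => W.
  apply: eventually_forall => S.
  have [BQ|] := boolP (B \in Q); last by exists 0.
  have [VW|] := boolP (V \subset W); last by exists 0.
  have [WB|] := boolP (W \subset B); last by exists 0.
  have [S0|] := boolP (S != finset.set0); last by exists 0.
  have [SW|] := boolP (S \proper W); last by exists 0.
  have [c c0 lawV] := process_law_ge gaussX (eql V).
  (* Monotonicity passes from [V] to the larger [W]; the strict inequality comes from [S] being a
     nonempty proper subset of [W] inside one block. *)
  have gap : energy (l V) < energy (l S) + #|W :\: S|%:R / a.
    apply: le_lt_trans (energy_mono symA (eql W) (eql V) VW) _.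
    by apply: (energy_subadditive symA a0 diagA Age0 (fun i j => Ablock B i j BQ)).
  have [h0 h0P] := eventually_gauss_le (energy (l V)) c0 eps0 gap.
  exists h0 => h /h0P hle _ _ _ _ _ _ h_ge0.
  apply: (@le_trans _ _ (eps *
    (c * expR (- (h ^+ 2 * energy (l V)) / 2 - energy (l V) * h)))); last first.
    by rewrite ler_pM2l// lawV.
  apply: le_trans hle.
  have marg0 : 0 <= marg h i by apply: sumr_ge0 => Z _; exact: process_law_ge0.
  apply: (@le_trans _ _ (expR (- (h ^+ 2 * (1 / a)) / 2) ^+ #|W :\: S| *
      expR (- (h ^+ 2 * energy (l S)) / 2))).
    apply: ler_pM; rewrite ?exprn_ge0//.
    + by apply: sumr_ge0 => Z _; exact: process_law_ge0.
    + by rewrite lerXn2r ?nnegrE ?expR_ge0// marg_le.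
    + exact: (upper_sum_le gaussX).
  rewrite -expRM_natl -expRD ler_expR.
  by rewrite mulrDr; lra.
have [h3 small] : exists h0, forall h, h0 <= h ->
    forall (i : 'I_n) (V : {set 'I_n}),
      (1 < #|V|)%N -> 0 <= h -> upper_sum (law h) V <= eps * marg h i.
  apply: eventually_forall => i; apply: eventually_forall => V.
  have [cardV|] := boolP (1 < #|V|)%N; last by exists 0.
  have [c c0 lawi] := process_law_ge gaussX (eql [set i]%SET).
  have gap : energy (l [set i]%SET) < energy (l V).
    rewrite (energy_set1 a0 (diagA i) (eql _)).
    apply: (energy_gt symA posA a0 diagA _ (eql V) cardV) => S.
    by exists (l S).
  have [h0 h0P] := eventually_gauss_le (energy (l [set i]%SET)) c0 eps0 gap.
  exists h0 => h /h0P hle _ h_ge0.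
  apply: le_trans (upper_sum_le gaussX h_ge0 (eql V)) _.
  apply: le_trans hle _; rewrite ler_pM2l//.
  apply: le_trans (lawi _ h_ge0) _.
  by apply: le_upper_sum => Z; exact: process_law_ge0.
(* The sum of absolute values is nonnegative and exceeds all three thresholds. *)
exists (`|h1| + `|h2| + `|h3|) => h hh.
have [n1 n2 n3] : [/\ h1 <= `|h1|, h2 <= `|h2| & h3 <= `|h3|].
  by split; exact: ler_norm.
have [p1 p2 p3] : [/\ 0 <= `|h1|, 0 <= `|h2| & 0 <= `|h3|] by [].
have h_ge0 : 0 <= h by lra.
have mY i : measurable [set w | threshold X h i w] by exact: measurable_threshold.
have law0 Z : 0 <= law h Z by exact: process_law_ge0.
have lawT : upper_sum (law h) finset.set0 = 1 by exact: upper_sum_law_total.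
(* [p] is the common marginal; for the empty index set, [eps] is taken instead. *)
have [p [p0 peps margp]] : exists p, [/\ 0 < p, p <= eps & forall i, marg h i = p].
  have [i0|no_i] := pickP 'I_n; last first.
    by exists eps; split=> // i; have := no_i i.
  exists (marg h i0); split.
  - have [c c0 /(_ h h_ge0) lawi] := process_law_ge gaussX (eql [set i0]%SET).
    apply: lt_le_trans (le_upper_sum law0 _); apply: lt_le_trans lawi.
    by rewrite mulr_gt0 ?expR_gt0.
  - by apply: le_trans (marg_le _ _ h_ge0) _; apply: small_marg; lra.
  - move=> ?; apply: EFin_inj; rewrite !upper_sum_set1//.
    exact: (exceedance_eq gaussX).
have p2lt : p < 1 / 2 by lra.
have bern m : (1 < m)%N -> bernoulli_moment p m != 0.
  by move=> m1; rewrite gt_eqF// bernoulli_moment_gt0.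
apply: (color_process_trace_mixture mY (p := p) (Q := Q)
  (W := fun U => \prod_(B in Q) block_weight p (law h) B (U :&: B))) => //.
- by apply/andP; split; lra.
- move=> U; apply: prodr_ge0 => B BQ.
  apply: (block_weight_ge0 (eps := eps)) => //; last exact: finset.subsetIr.
  + move=> V W S VW WB cardV S0 SW.
    have /card_gt0P[i iV] : (0 < #|V|)%N by exact: ltnW.
    by rewrite -(margp i); apply: (dominated h _ i B) => //; lra.
  + move=> V VB cardV.
    have /card_gt0P[i iV] : (0 < #|V|)%N by exact: ltnW.
    by rewrite -(margp i); apply: small => //; lra.
- exact: sum_block_weight.
- move=> Z; apply: trace_mixture => // B S BQ.
  by apply: (upper_sum_indep gaussX) => i j; exact: Across.
Qed.
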